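(* Let $p,q$ be distinct primes. Then $rb(\mathbb{Z}_q,p)=4$ if and only if $p,q$ satisfy neither of the following conditions: (1) $p$ generates the multiplicative group $\mathbb{Z}_q^*$; (2) the multiplicative order of $p$ in $\mathbb{Z}_q^*$ equals $(q-1)/2$ and $(q-1)/2$ is odd. Otherwise (i.e. if at least one of the conditions holds), $rb(\mathbb{Z}_q,p)=3$.
   Context: $\mathbb{Z}_n$ denotes the cyclic group of order $n$ and $\mathbb{Z}_q^*$ the multiplicative group of nonzero residues mod a prime $q$. An $r$-coloring of $\mathbb{Z}_n$ is a surjective map $c:\mathbb{Z}_n\to\{1,\dots,r\}$. For a fixed integer $k$, a triple is any $(x_1,x_2,x_3)\in\mathbb{Z}_n^3$ with $x_1+x_2\equiv kx_3 \pmod n$. A triple is rainbow under $c$ if $c(x_1),c(x_2),c(x_3)$ are pairwise distinct; $c$ is rainbow-free if no triple is rainbow. The rainbow number $rb(\mathbb{Z}_n,k)$ is the smallest positive integer $r$ such that every $r$-coloring of $\mathbb{Z}_n$ admits a rainbow triple (by convention $rb(\mathbb{Z}_n,k)=n+1$ if no such $r$ exists). *)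

(* Defs.v *)
From mathcomp Require Import all_boot all_order all_algebra all_fingroup all_solvable.

Set Implicit Arguments.
Unset Strict Implicit.
Unset Printing Implicit Defensive.

(* Z_n is represented by the residues 'I_n = {0, ..., n-1}, with the equation
   of a triple read as a congruence of integers; unlike 'Z_n, this has n
   elements for every n, including n = 1. *)
Definition triple (n : nat) (k : int) (x1 x2 x3 : 'I_n) : bool :=
  ((x1%:Z + x2%:Z)%R == (k * x3%:Z)%R %[mod n%:Z])%Z.

(* The colors {1, ..., r} are renumbered as 'I_r = {0, ..., r-1}. *)
Definition is_coloring (n r : nat) (c : {ffun 'I_n -> 'I_r}) : bool :=
  [forall i : 'I_r, exists x : 'I_n, c x == i].

Definition rainbow (n r : nat) (c : {ffun 'I_n -> 'I_r}) (x1 x2 x3 : 'I_n) :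
    bool :=
  [&& c x1 != c x2, c x1 != c x3 & c x2 != c x3].

Definition rainbow_free (n : nat) (k : int) (r : nat)
    (c : {ffun 'I_n -> 'I_r}) : bool :=
  ~~ [exists x1, exists x2, exists x3,
        triple k x1 x2 x3 && rainbow c x1 x2 x3].

Definition rainbow_forcing (n : nat) (k : int) (r : nat) : bool :=
  (0 < r) &&
  [forall c : {ffun 'I_n -> 'I_r}, is_coloring c ==> ~~ rainbow_free k c].

Lemma rainbow_forcing_succ (n : nat) (k : int) : rainbow_forcing n k n.+1.
Proof.
apply/andP; split=> //; apply/forallP=> c; apply/implyP=> /forallP c_onto.
have /subset_leq_card : [set: 'I_n.+1] \subset c @: [set: 'I_n].
  apply/subsetP=> i _; have /existsP[x /eqP <-] := c_onto i.
  by rewrite imset_f ?inE.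
move=> le_card; have := leq_trans le_card (leq_imset_card _ _).
by rewrite !cardsT !card_ord ltnn.
Qed.

Lemma rainbow_forcing_ex (n : nat) (k : int) :
  exists r, rainbow_forcing n k r.
Proof. by exists n.+1; apply: rainbow_forcing_succ. Qed.

(* Since no (n+1)-coloring of Z_n exists, r = n+1 is vacuously admissible, so
   the minimum is n+1 when no r <= n is: this is the usual convention. *)
Definition rb (n : nat) (k : int) : nat := ex_minn (rainbow_forcing_ex n k).

(* The residue of m as an element of the multiplicative group of Z_n, for
   1 < n and m coprime to n (see residue_unitE); junk value 1 when m is not
   invertible. *)
Definition residue_unit (n m : nat) : {unit 'Z_n} :=
  insubd (1%g : {unit 'Z_n}) (m%:R%R : 'Z_n).

Lemma residue_unitE (n m : nat) :
  1 < n -> coprime n m -> val (residue_unit n m) = (m%:R)%R.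
Proof.
by move=> n_gt1 co_nm; rewrite /residue_unit insubdK // unfold_in /= unitZpE.
Qed.

Definition generates_units (q p : nat) : bool :=
  generator (units_Zp q) (residue_unit q p).

(* For q = 2 the truncated half (q-1)./2 is 0, which is not odd, so the
   condition fails, as it does with the exact quotient 1/2. *)
Definition odd_half_order (q p : nat) : bool :=
  (#[residue_unit q p]%g == (q.-1)./2) && odd (q.-1)./2.

(* Main.v *)
Require Import Defs.
From mathcomp Require Import all_boot all_order all_algebra all_fingroup all_solvable.
From mathcomp Require Import zify ring.

(* For the lower bound, give 0 one color, the subgroup H generated by -1 and p
   a second one, and the rest of the field a third one. A rainbow triple would
   contain 0, but then its other two entries would differ by a factor in H.
   The third color occurs unless H is the whole multiplicative group, which is
   what one of the conditions (1) and (2) says.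

   For the upper bounds, let k = p. Given a rainbow-free coloring with three
   colors, x in A and y in B force (x + y) / k into A or B, so that sumsets of
   two classes are small. When all classes have at least two elements, an
   inverse theorem for sumsets (through Hamidoune's atoms) shows that the
   smallest class consists of at most two progressions with some difference d;
   walking around the group with step d, one meets at most seven monochromatic
   runs, and a case analysis of their cyclic words leads to a difference for
   which all three classes are progressions. If k is not -1, then k and 1/k
   must both be 1, -1, 2 or -2, whence k = 1, which is excluded separately. So
   some class is a singleton {s}. If s = 0, or k = 2 and one translates s to 0,
   the coloring is constant on the cosets of H; otherwise it is, away from s,
   invariant under a nonzero translation. With four colors, merging a class
   successively with each of the other three makes all merged classes
   progressions with a common difference, which leaves the first class no
   boundary. *)

Set Implicit Arguments.
Unset Strict Implicit.
Unset Printing Implicit Defensive.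

Import GRing.Theory.

Local Open Scope ring_scope.

(** * Sumsets in a group of prime order *)

(** For two color classes the equation only yields |A + B| <= |A| + |B|, one above the
    Cauchy-Davenport minimum, so Vosper's theorem does not apply and a class may a priori be cut
    into two progressions; this one unit of slack is what makes the case analysis of words
    necessary. The second device is that one element often solves the equation with two different
    pairs of colors: two neighbours [p], [p + d] in C, combined with a point where the color changes
    between A and B, produce an element that can only lie in C. Cauchy-Davenport then bounds the
    number of changes between A and B by one more than the number of runs of C, so that two runs of
    C leave at most five for A and B together. Played on each variable of the equation, the same
    argument links the steps d, k d and d / k; this is the source of the conditions on k and 1 /
    k. *)

Definition sumset (V : finZmodType) (X Y : {set V}) : {set V} :=
  [set x + y | x in X, y in Y].

Definition shift (V : finZmodType) (d : V) (X : {set V}) : {set V} :=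
  [set x | x - d \in X].

Section PrimeOrder.

Variable V : finZmodType.
Hypothesis V_prime : prime #|V|.
Implicit Types (X Y S M : {set V}) (d t : V).

Lemma shiftE d X : shift d X = [set x + d | x in X].
Proof.
apply/setP=> y; rewrite inE; apply/idP/imsetP=> [yX|[x xX ->]].
  by exists (y - d); rewrite ?subrK.
by rewrite addrK.
Qed.

Lemma card_shift d X : #|shift d X| = #|X|.
Proof. by rewrite shiftE card_imset //; apply: addIr. Qed.

Lemma shift0 X : shift 0 X = X.
Proof. by apply/setP=> x; rewrite inE subr0. Qed.

Lemma shift_shift d t X : shift d (shift t X) = shift (t + d) X.
Proof. by apply/setP=> x; rewrite !inE opprD addrCA addrC. Qed.

Lemma shiftI d X Y : shift d (X :&: Y) = shift d X :&: shift d Y.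
Proof. by apply/setP=> x; rewrite !inE. Qed.

Lemma mem_sumset X Y x y : x \in X -> y \in Y -> x + y \in sumset X Y.
Proof. by move=> xX yY; apply/imset2P; exists x y. Qed.

Lemma sumsetC X Y : sumset X Y = sumset Y X.
Proof.
by apply/setP=> z; apply/imset2P/imset2P=> [] [x y ? ? ->]; exists y x;
  rewrite // addrC.
Qed.

Lemma sumsetS X X' Y : X \subset X' -> sumset X Y \subset sumset X' Y.
Proof. by move=> sX; apply: imset2Sl. Qed.

Lemma sumsetU X X' Y : sumset (X :|: X') Y = sumset X Y :|: sumset X' Y.
Proof.
apply/setP=> z; rewrite !inE; apply/imset2P/orP.
  move=> [x y]; rewrite inE => /orP[] xX yY ->; [left|right];
  exact: mem_sumset.
by move=> [] /imset2P[x y xX yY ->]; exists x y; rewrite ?inE ?xX ?orbT.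
Qed.

Lemma sumset_shift d X Y : sumset (shift d X) Y = shift d (sumset X Y).
Proof.
apply/setP=> z; rewrite inE; apply/imset2P/imset2P.
  by move=> [x y]; rewrite inE => xX yY ->; exists (x - d) y; rewrite // addrAC.
move=> [x y xX yY e]; exists (x + d) y; rewrite ?inE ?addrK //.
by rewrite addrAC -e subrK.
Qed.

Lemma sumset1 d X : sumset X [set d] = shift d X.
Proof.
by rewrite shiftE; apply/setP=> z; apply/imset2P/imsetP=>
  [[x y xX /set1P-> ->]|[x xX ->]]; [exists x|exists x d; rewrite ?inE].
Qed.

Lemma sumset2 d t X : sumset X [set d; t] = shift d X :|: shift t X.
Proof. by rewrite sumsetC sumsetU ![sumset [set _] _]sumsetC !sumset1. Qed.

Lemma leq_card_sumset X Y y : y \in Y -> (#|X| <= #|sumset X Y|)%N.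
Proof.
move=> yY; rewrite -(card_shift y) -sumset1 sumsetC [sumset X _]sumsetC.
by apply/subset_leq_card/sumsetS; rewrite sub1set.
Qed.

Lemma mulrn_card d : d *+ #|V| = 0.
Proof.
have := @expg_cardG V [set: V]%G d; rewrite cardsT inE FinRing.Theory.zmodXgE.
exact.
Qed.

Lemma mulrn_eq0_card d n : d != 0 -> (d *+ n == 0) = (#|V| %| n)%N.
Proof.
move=> d0; have := @order_dvdn V d n; rewrite FinRing.Theory.zmodXgE => <-.
congr (_ %| _)%N; have := @order_dvdG V [set: V]%G d; rewrite cardsT inE.
move=> /(_ isT) /(primeP V_prime).2 /orP[|/eqP//]; rewrite order_eq1.
by rewrite -[1%g]/(0 : V) (negPf d0).
Qed.

Lemma mulrn_inj d i j : d != 0 -> (i < #|V|)%N -> (j < #|V|)%N ->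
  d *+ i = d *+ j -> i = j.
Proof.
move=> d0; wlog ij : i j / (i <= j)%N.
  by move=> H iq jq e; case: (leqP i j) => [|/ltnW] h; [|symmetry]; apply: H.
move=> iq jq e.
have : (d *+ (j - i) == 0) by rewrite mulrnBr // e subrr.
rewrite mulrn_eq0_card // => /dvdn_leq; lia.
Qed.

Lemma mulrn_surj d x : d != 0 -> exists2 i, (i < #|V|)%N & x = d *+ i.
Proof.
move=> d0; pose g (i : 'I_#|V|) := d *+ i.
have g_inj : injective g.
  by move=> i j /(mulrn_inj d0 (ltn_ord i) (ltn_ord j)) /val_inj.
have gT : g @: setT = [set: V].
  by apply/eqP; rewrite eqEcard subsetT card_imset // !cardsT card_ord leqnn.
have : x \in g @: setT by rewrite gT inE.
by case/imsetP=> i _ ->; exists i.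
Qed.

Lemma addrn_surj d x y : d != 0 -> exists2 i, (i < #|V|)%N & y = x + d *+ i.
Proof.
by move=> d0; have [i ? e] := mulrn_surj (y - x) d0; exists i;
  rewrite // -e addrC subrK.
Qed.

Lemma shift_invariant d X : d != 0 -> shift d X = X -> X = set0 \/ X = setT.
Proof.
move=> d0 e; case: (set_0Vmem X) => [|[x xX]]; first by left.
right; apply/setP=> y; rewrite inE; have [i _ ->] := addrn_surj x y d0.
elim: i => [|i IH]; first by rewrite mulr0n addr0.
by rewrite -e inE mulrS addrCA addrC addrK.
Qed.

(* Induction on the size of [Y]: Dyson's transform replaces [X] and [Y] by
   [X :|: (Y + e)] and [Y :&: (X - e)], for some [e] that makes [Y] shrink. *)
Lemma cauchy_davenport X Y : X != set0 -> Y != set0 ->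
  (minn #|V| (#|X| + #|Y|).-1 <= #|sumset X Y|)%N.
Proof.
move: {2}#|Y| (leqnn #|Y|) => n; elim: n X Y => [|n IH] X Y.
  by rewrite leqn0 cards_eq0 => ->.
move=> leY X0 Y0; have [y yY] := set0Pn _ Y0.
have [[z] zY zy|Y1] : {z | z \in Y & z != y} + {Y = [set y]}.
  case: (pickP [pred z in Y | z != y]) => [z /andP[]|none]; first by left; exists z.
  right; apply/setP=> z; rewrite inE; apply/idP/eqP=> [zY|-> //].
  by have := none z; rewrite /= zY => /negPf; case: eqP.
  2: by rewrite Y1 sumset1 card_shift cards1 addn1 /= geq_minr.
have [->|XT] := eqVneq X setT.
  by apply: leq_trans (leq_card_sumset _ yY); rewrite cardsT geq_minl.
have [x xX xX'] : exists2 x, x \in X & x + (z - y) \notin X.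
  apply/exists_inP; apply: contraT; rewrite negb_exists_in => /forall_inP H.
  have /shift_invariant[] : shift (z - y) X = X.
  - apply/eqP; rewrite eqEcard card_shift leqnn andbT; apply/subsetP=> u.
    by rewrite inE => /H; rewrite negbK subrK.
  - by rewrite subr_eq0.
  - by move/eqP; rewrite (negPf X0).
  - by move/eqP; rewrite (negPf XT).
pose e := x - y.
set X' := X :|: shift e Y; set Y' := Y :&: shift (- e) X.
have yY' : y \in Y' by rewrite !inE yY opprK /e addrC subrK.
have zY' : z \notin Y'.
  rewrite !inE zY opprK /e; apply: contra xX'.
  by rewrite addrCA addrA [_ + z]addrC -addrA.
have cXY : (#|X'| + #|Y'| = #|X| + #|Y|)%N.
  rewrite -(card_shift e Y) -(card_shift e Y') shiftI shift_shift addNr shift0.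
  by rewrite setIC cardsUI.
have sXY : sumset X' Y' \subset sumset X Y.
  apply/subsetP=> _ /imset2P[u v uX' + ->]; rewrite !inE opprK => /andP[vY vX].
  move: uX'; rewrite !inE => /orP[uX|uY]; first exact: mem_sumset.
  by rewrite -[u](subrK e) -addrA addrC [e + v]addrC mem_sumset.
have ltY : (#|Y'| <= n)%N.
  rewrite -ltnS; apply: leq_trans leY; apply: proper_card.
  by apply/properP; split; [apply: subsetIl|exists z].
apply: leq_trans (subset_leq_card sXY); rewrite -cXY; apply: IH => //.
- by apply/set0Pn; exists x; rewrite inE xX.
- by apply/set0Pn; exists y.
Qed.

End PrimeOrder.

(** * Sets with a small sumset *)

(** For a proper nonempty [X] in a group of prime order and [d != 0], this is the number of maximal
    progressions of difference [d] that make up [X], each counted at its last element. The value 1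
    thus encodes that [X] is a single progression. *)
Definition exits (V : finZmodType) (d : V) (X : {set V}) : nat :=
  #|[set x in X | x + d \notin X]|.

Section Atoms.

Variable V : finZmodType.
Implicit Types (X Y S M Z : {set V}) (d t u : V).

Lemma shift_exits d X :
  shift d [set x in X | x + d \notin X] = shift d X :\: X.
Proof. by apply/setP=> x; rewrite !inE subrK andbC. Qed.

Lemma card_setU_shift d X : #|X :|: shift d X| = (#|X| + exits d X)%N.
Proof.
rewrite /exits -(card_shift d [set x in X | _]) shift_exits.
have := cardsUI X (shift d X); have := cardsID X (shift d X).
rewrite setIC; lia.
Qed.

Lemma card_setI_shift d X : (#|X :&: shift d X| + exits d X)%N = #|X|.
Proof.
have := cardsUI X (shift d X); rewrite card_setU_shift card_shift; lia.
Qed.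

Lemma exitsN d X : exits (- d) X = exits d X.
Proof.
have e : shift d (X :&: shift (- d) X) = X :&: shift d X.
  by rewrite shiftI shift_shift addNr shift0 setIC.
have := card_setI_shift d X; have := card_setI_shift (- d) X.
rewrite -e card_shift; lia.
Qed.

Lemma card_gt2P (T : finType) (A : {set T}) : (2 < #|A|)%N ->
  exists x y z, [/\ x \in A, y \in A & z \in A] /\ [/\ x != y, x != z & y != z].
Proof.
move=> A3; have /card_gt0P[x xA] : (0 < #|A|)%N by lia.
have /card_gt0P[y] : (0 < #|A :\ x|)%N by rewrite (cardsD1 x A) xA in A3; lia.
rewrite !inE => /andP[yx yA].
have /card_gt0P[z] : (0 < #|A :\ x :\ y|)%N.
  by rewrite (cardsD1 x A) xA (cardsD1 y) !inE yx yA in A3; lia.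
rewrite !inE => /and3P[zy zx zA]; exists x, y, z.
by split; split; rewrite // eq_sym.
Qed.

(** Three translates of [M] by elements of [Y] meet pairwise in at most one point, so their union
    has at least 3|M| - 3 elements. *)
Lemma sidon_sumset_card M Y : (forall t, t != 0 -> (#|M :&: shift t M| <= 1)%N) ->
  (2 < #|Y|)%N -> (3 * #|M| <= #|sumset M Y| + 3)%N.
Proof.
move=> sM /card_gt2P[x [y [z [[xY yY zY] [xy xz yz]]]]].
have sI u v : u != v -> (#|shift u M :&: shift v M| <= 1)%N.
  move=> uv; rewrite -(card_shift (- v)) shiftI !shift_shift subrr shift0 setIC.
  by apply: sM; rewrite subr_eq0.
have := sI x y xy; have := sI x z xz; have := sI y z yz.
have : (#|shift x M :|: shift y M :|: shift z M| <= #|sumset M Y|)%N.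
  apply: subset_leq_card; rewrite !subUset -!sumset1 ![sumset M _]sumsetC.
  by rewrite !sumsetS ?sub1set.
have := cardsUI (shift x M :|: shift y M) (shift z M).
have := cardsUI (shift x M) (shift y M).
have : (#|(shift x M :|: shift y M) :&: shift z M| <=
   #|shift x M :&: shift z M| + #|shift y M :&: shift z M|)%N.
  by rewrite setIUl; apply: leq_card_setU.
rewrite !card_shift; lia.
Qed.

Lemma sumset_pair_card S x y :
  #|sumset [set x; y] S| = (#|S| + exits (y - x)%R S)%N.
Proof.
rewrite sumsetC sumset2 -(card_shift (- x)).
have -> : shift (- x) (shift x S :|: shift y S) = S :|: shift (y - x) S.
  by apply/setP=> z; rewrite !inE opprK addrK opprB addrA.
exact: card_setU_shift.
Qed.

Hypothesis V_prime : prime #|V|.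

(* Read along [t], the set [Z] is a union of strings, and translation by [- u]
   carries a string of length at least two, minus its first point, onto a
   whole string: the lengths of the strings take all values up to the
   largest, so that [n] strings have total length at most [n (n + 1) / 2]. *)
Lemma triangle_card n Z t u : t != 0 -> t != u -> Z != setT ->
    (forall z, z \in Z -> (z - t \in Z) = (z - u \in Z)) ->
    (forall z, z - t \in Z -> z - u \in Z -> z \in Z) ->
    #|Z :\: shift t Z| = n -> (n < #|V|)%N -> (2 * #|Z| <= n * n.+1)%N.
Proof.
elim/ltn_ind: n Z => n IH Z t0 tu ZT Htu Hcl En nq.
pose E Z := Z :\: shift t Z; pose D := Z :&: shift t Z.
have cZ : #|Z| = (n + #|D|)%N by rewrite -En addnC cardsID.
have memE z : (z \in E Z) = (z \in Z) && (z - t \notin Z).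
  by rewrite !inE andbC.
have memD z : (z \in D) = (z \in Z) && (z - t \in Z) by rewrite !inE.
have memED z : (z \in E D) = (z \in D) && (z - t \notin D).
  by rewrite !inE andbC.
have sub_t : shift (- t) (E D) \subset E Z.
  apply/subsetP=> z; rewrite inE opprK memED memE !memD addrK.
  by case/andP=> /andP[_ ->] /=.
have sub_u : shift (- u) (E D) \subset E Z.
  apply/subsetP=> z; rewrite inE opprK; set w := z + u => wED.
  have -> : z = w - u by rewrite addrK.
  move: wED; rewrite memED memE !memD => /andP[/andP[wZ wtZ]].
  by rewrite -(Htu w) // wtZ /= (Htu _ wtZ) (addrAC w (- u)).
have leED : (#|E D| <= n)%N.
  by rewrite -En -(card_shift (- t)); apply: subset_leq_card.
have [n0|n_gt0] := posnP n.
  have DZ : D = Z by apply/eqP; rewrite eqEcard subsetIl cZ n0 /=.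
  have sZ : shift t Z = Z.
    by apply/esym/eqP; rewrite eqEcard card_shift leqnn andbT; apply/setIidPl.
  by have [->|/eqP] := shift_invariant V_prime t0 sZ;
    rewrite ?cards0 // (negPf ZT).
(* Some string is a single point: otherwise both translates of [E D] would be all of [E Z], and
   [E D] would be invariant under the nonzero translation by [t - u]. *)
have ltED : (#|E D| < n)%N.
  rewrite ltn_neqAle leED andbT; apply/eqP=> ED.
  have et : shift (- t) (E D) = E Z.
    by apply/eqP; rewrite eqEcard sub_t card_shift ED En leqnn.
  have eu : shift (- u) (E D) = E Z.
    by apply/eqP; rewrite eqEcard sub_u card_shift ED En leqnn.
  have : shift (t - u) (E D) = E D.
    by rewrite addrC -shift_shift eu -et shift_shift addNr shift0.
  move/(shift_invariant V_prime _); rewrite subr_eq0 => /(_ tu) [] e.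
    by move: ED; rewrite e cards0; lia.
  by move: nq; rewrite -ED e cardsT ltnn.
have := IH _ ltED D t0 tu _ _ _ erefl (ltn_trans ltED nq).
have -> : D != setT.
  by apply: contraNneq ZT => DT; rewrite -subTset -DT subsetIl.
have H1 z : z \in D -> (z - t \in D) = (z - u \in D).
  rewrite !memD => /andP[zZ ztZ].
  by rewrite ztZ -(Htu z zZ) ztZ /= (Htu _ ztZ) addrAC.
have H2 z : z - t \in D -> z - u \in D -> z \in D.
  by rewrite !memD => /andP[h _] /andP[h' _]; rewrite (Hcl z) // h.
(* [D] has at most n - 1 strings, so 2|Z| = 2n + 2|D| is at most 2n + (n - 1) n. *)
move=> /(_ isT H1 H2); rewrite cZ; nia.
Qed.

(* Following Hamidoune, [M] minimizes the difference of the sizes of [M + S]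
   and [M], and then its own size; by submodularity, two distinct translates
   of [M] cannot meet in more than one point. *)
Lemma small_defect_atom S X : (1 < #|X|)%N -> (0 < #|S|)%N ->
    (#|sumset X S|.+2 <= #|V|)%N ->
  exists M, [/\ (1 < #|M|)%N, (#|sumset M S|.+2 <= #|V|)%N,
    (#|sumset M S| + #|X| <= #|M| + #|sumset X S|)%N &
    forall t, t != 0 -> (#|M :&: shift t M| <= 1)%N].
Proof.
move=> X2 /card_gt0P[s sS] XS.
have leS Y : (#|Y| <= #|sumset Y S|)%N by apply: leq_card_sumset sS.
pose delta Y := (#|sumset Y S| - #|Y|)%N.
have deltaK Y : (#|Y| + delta Y)%N = #|sumset Y S| by rewrite subnKC.
pose adm := [pred Y : {set V} | (1 < #|Y|)%N && (#|sumset Y S|.+2 <= #|V|)%N].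
(* The lexicographic order on defect and size, coded as one number since sizes are at most |V|. *)
pose key Y := (delta Y * #|V|.+1 + #|Y|)%N.
have admX : adm X by rewrite /= X2.
case: (arg_minnP key admX) => M /andP[M2 MS] Mmin.
have minP Y : adm Y -> (delta M < delta Y)%N \/
    delta M = delta Y /\ (#|M| <= #|Y|)%N.
  move=> /Mmin; rewrite /key => le.
  have [|gt|eq] := ltngtP (delta M) (delta Y); [by left| |by right; lia].
  have leY : (#|Y| <= #|V|)%N by apply: max_card.
  move: gt le leY; move: (delta Y) (delta M) #|Y| #|M| #|V| => a b c e q; nia.
exists M; split=> //.
  by have := deltaK M; have := deltaK X; case: (minP X admX); lia.
move=> t t0; rewrite leqNgt; apply/negP=> I2.
set I := M :&: shift t M in I2; set U := M :|: shift t M.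
have cIU : (#|U| + #|I| = 2 * #|M|)%N.
  by rewrite cardsUI card_shift mul2n addnn.
have sIM : I \subset M by apply: subsetIl.
have ltIM : (#|I| < #|M|)%N.
  apply: proper_card; rewrite properEneq sIM andbT; apply/eqP=> /setIidPl sM.
  have : shift t M = M.
    by apply/esym/eqP; rewrite eqEcard sM card_shift leqnn.
  case/(shift_invariant V_prime t0) => eM; first by rewrite eM cards0 in M2.
  have cT : #|[set: V]| = #|V| by apply: cardsT.
  by have := leS M; move: MS; rewrite eM cT; lia.
have sumU : sumset U S = sumset M S :|: shift t (sumset M S).
  by rewrite sumsetU sumset_shift.
have sumI : sumset I S \subset sumset M S :&: shift t (sumset M S).
  rewrite subsetI -sumset_shift !sumsetS //; exact: subsetIr.
have := subset_leq_card sumI; have := cardsUI (sumset M S) (shift t (sumset M S)).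
rewrite -sumU card_shift => eUI leI.
have admI : adm I.
  rewrite /= I2 /=; apply: leq_trans MS; rewrite !ltnS.
  by apply/subset_leq_card/sumsetS.
have dI : (delta M < delta I)%N by case: (minP I admI) => // -[_]; lia.
(* the complement of [sumset M S], reflected, is admissible too *)
pose M' : {set V} := [set x | - x \notin sumset M S].
have cM' : (#|M'| + #|sumset M S| = #|V|)%N.
  have -> : M' = ~: [set - x | x in sumset M S].
    apply/setP=> x; rewrite !inE; congr (~~ _); apply/idP/imsetP=> [xM|[y yM ->]].
      by exists (- x); rewrite ?opprK.
    by rewrite opprK.
  by rewrite addnC -(card_imset (mem (sumset M S)) oppr_inj) cardsC.
have sM' : (#|sumset M' S| + #|M| <= #|V|)%N.
  rewrite -(card_imset (mem M) oppr_inj) -cardsUI.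
  rewrite (_ : _ :&: _ = set0) ?cards0 ?addn0 ?max_card //.
  apply/setP=> z; rewrite !inE; apply/negP=> /andP[/imset2P[x y xM yS ->]].
  case/imsetP=> m mM e; move: xM; rewrite inE => /negP; apply.
  have -> : - x = m + y by rewrite -[x](addrK y) e opprB opprK addrC.
  exact: mem_sumset.
have admM' : adm M'.
  have h1 : (1 < #|M'|)%N by lia.
  have h2 : (#|sumset M' S|.+2 <= #|V|)%N by lia.
  by apply/andP.
clearbody M' delta.
(* The defect of [M'] is at most that of [M], so minimality compares the sizes and gives |M| + |M +
   S| <= |V|. This is the room that makes the union [U] admissible, although its defect is below the
   minimum. *)
have leMM' : (#|M| <= #|M'|)%N.
  have := deltaK M'; have := deltaK M; case: (minP M' admM'); lia.
have dU : (delta U < delta M)%N.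
  have := deltaK U; have := deltaK I; have := deltaK M; lia.
have admU : adm U.
  have h1 : (1 < #|U|)%N by lia.
  have h2 : (#|sumset U S|.+2 <= #|V|)%N.
    by have := deltaK U; have := deltaK M; lia.
  exact/andP.
by case: (minP U admU); lia.
Qed.

(* The conclusion says that [S] is a union of at most two progressions of
   difference [d]. An atom [M] of [S] with two elements [x] and [y] gives
   [d = y - x]. An atom with more elements has exactly three, because its
   translates are almost disjoint; if no [d] worked, then [triangle_card] would
   bound the complement of [S]. *)
Lemma two_strings S X : (1 < #|S|)%N -> (#|S| + 7 <= #|V|)%N ->
    (1 < #|X|)%N -> (#|sumset X S|.+2 <= #|V|)%N ->
    (#|sumset X S| <= #|X| + #|S|)%N ->
  exists2 d, d != 0 & (exits d S <= 2)%N.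
Proof.
move=> S2 S7 X2 XS XSle.
have [M [M2 MS MX sM]] := small_defect_atom X2 (ltnW S2) XS.
have {MX XS X2 XSle X} MSle : (#|sumset M S| <= #|M| + #|S|)%N by lia.
case: (pickP [pred d : V | (d != 0) && (exits d S <= 2)%N]).
  by move=> d /andP[]; exists d.
move=> none; have {none} S3 d : d != 0 -> (2 < exits d S)%N.
  by move=> d0; have := none d; rewrite /= d0 ltnNge => /negbT.
exfalso.
have [M3|M2'] := ltnP 2 #|M|; last first.
  have /cards2P[x [y [xy eM]]] : #|M| == 2%N by lia.
  have := S3 (y - x); rewrite subr_eq0 eq_sym xy => /(_ isT).
  move: MSle; rewrite eM sumset_pair_card cards2 xy; lia.
(* The roles are exchanged: [S] now witnesses a small sumset with [M], and [N] is an atom of [M]. If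
   [N] has at least three elements, almost disjointness of the translates of both sets gives |M| +
   |N| <= 6; if [N] is a pair, adding it to [M] creates at least |M| - 1 new elements, where at most
   two are affordable. *)
have {M2} cM : #|M| = 3%N.
  have [N [N2 NM Nle sN]] : exists N : {set V}, [/\ (1 < #|N|)%N,
      (#|sumset N M|.+2 <= #|V|)%N,
      (#|sumset N M| + #|S| <= #|N| + #|sumset S M|)%N &
      forall t, t != 0 -> (#|N :&: shift t N| <= 1)%N].
    by apply: small_defect_atom; rewrite // 1?sumsetC // ltnW.
  rewrite (sumsetC S) in Nle.
  have [N3|N2'] := ltnP 2 #|N|.
    have := sidon_sumset_card sM N3; have := sidon_sumset_card sN M3.
    rewrite (sumsetC M); lia.
  have /cards2P[x [y [xy eN]]] : #|N| == 2%N by lia.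
  have := sM (y - x); rewrite subr_eq0 eq_sym xy => /(_ isT).
  have := card_setI_shift (y - x) M.
  move: Nle; rewrite eN sumset_pair_card cards2 xy; lia.
have [x [y [z [[xM yM zM] [xy xz yz]]]]] := card_gt2P M3.
pose W : {set V} := sumset M S; rewrite -/W cM in MSle.
(* Every nonzero difference has at least three exits, so any pair in [M] already produces the at
   most |S| + 3 elements of [W]. Comparing the three pairs yields the hypotheses of [triangle_card]
   for the complement of [S]. *)
have pairW u v : u \in M -> v \in M -> u != v -> sumset [set u; v] S = W.
  move=> uM vM uv; apply/eqP; rewrite eqEcard sumsetS ?subUset ?sub1set ?uM //=.
  rewrite sumset_pair_card; have := S3 (v - u).
  rewrite subr_eq0 eq_sym uv => /(_ isT) h; apply: leq_trans MSle _; lia.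
have inW u v w : u \in M -> v \in M -> u != v ->
    (w \in W) = (w - u \in S) || (w - v \in S).
  by move=> uM vM uv; rewrite -(pairW u v) // sumsetC sumset2 !inE.
pose Z := ~: S.
have inZ w : (w \in Z) = (w \notin S) by rewrite inE.
have cZ : (#|Z| + #|S| = #|V|)%N by rewrite addnC cardsC.
have xy0 : y - x != 0 by rewrite subr_eq0 eq_sym.
have xz0 : z - x != 0 by rewrite subr_eq0 eq_sym.
have Zn : #|Z :\: shift (y - x) Z| = 3%N.
  have -> : Z :\: shift (y - x) Z = shift (y - x) S :\: S.
    by apply/setP=> w; rewrite !inE negbK andbC.
  rewrite -shift_exits card_shift; have := S3 _ xy0; rewrite -/(exits _ _).
  have := sumset_pair_card S x y; rewrite pairW //; lia.
have tu : y - x != z - x by rewrite (inj_eq (addIr _)).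
have ZT : Z != setT.
  have cT : #|[set: V]| = #|V| by apply: cardsT.
  by apply/eqP=> ZT; move: cZ; rewrite ZT cT; lia.
have shiftx w v : (w + x) - v = w - (v - x) by rewrite opprB addrA addrAC.
have Htu w : w \in Z -> (w - (y - x) \in Z) = (w - (z - x) \in Z).
  rewrite !inZ => wS; congr (~~ _).
  have := inW x z (w + x) xM zM xz; rewrite (inW x y) // addrK (negPf wS) /=.
  by rewrite !shiftx.
have Hcl w : w - (y - x) \in Z -> w - (z - x) \in Z -> w \in Z.
  rewrite !inZ -!shiftx => /negPf wy /negPf wz.
  have := inW y z (w + x) yM zM yz; rewrite wy wz (inW x y) //.
  by rewrite addrK => /norP[].
(* Three strings of the complement have total length at most 1 + 2 + 3 = 6, against the 7 elements
   that the hypothesis leaves. *)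
have := triangle_card xy0 tu ZT Htu Hcl Zn; lia.
Qed.

End Atoms.

(** * Runs of a coloring along a progression *)

(* [w] lists the lengths and colors of the successive monochromatic runs of
   [f] on [s], [s + d], [s + 2 d] and so on. *)
Fixpoint runs (V : zmodType) (f : V -> nat) (d s : V) (w : seq (nat * nat)) :
    Prop :=
  if w is (l, c) :: w' then
    [/\ (0 < l)%N, forall i, (i < l)%N -> f (s + d *+ i) = c &
        runs f d (s + d *+ l) w']
  else True.

Definition total (w : seq (nat * nat)) : nat := sumn (unzip1 w).

Section Runs.

Variables (V : finZmodType) (f : V -> nat) (d : V).
Hypothesis V_prime : prime #|V|.
Hypothesis d0 : d != 0.
Implicit Types (s x : V) (w : seq (nat * nat)).

Lemma runs_cat s w1 w2 :
  runs f d s (w1 ++ w2) <-> runs f d s w1 /\ runs f d (s + d *+ total w1) w2.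
Proof.
elim: w1 s => [|[l c] w1 IH] s /=; first by rewrite mulr0n addr0; tauto.
rewrite /total /= mulrnDr addrA; split.
  by move=> [l0 H /IH[h1 h2]]; split.
by move=> [[l0 H h1] h2]; split=> //; apply/IH.
Qed.

Lemma runs_rot s w n : runs f d s w -> total w = #|V| ->
  exists s', runs f d s' (seq.rot n w) /\ total (seq.rot n w) = #|V|.
Proof.
rewrite -{1 2}[w](cat_take_drop n) /seq.rot /total /unzip1 map_cat sumn_cat.
rewrite runs_cat => -[h1 h2] e; exists (s + d *+ total (take n w)).
rewrite runs_cat map_cat sumn_cat addnC -addrA -mulrnDr.
by rewrite -/(unzip1 _) -/(total (take n w)) -/(unzip1 _) in e *; rewrite e mulrn_card addr0.
Qed.

Fixpoint rle s n : seq (nat * nat) :=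
  if n is n'.+1 then
    let w := rle (s + d) n' in
    if w is (l, c) :: w' then
      if c == f s then (l.+1, c) :: w' else (1%N, f s) :: w
    else [:: (1%N, f s)]
  else [::].

Lemma rle_cons s n : rle s n.+1 =
  if rle (s + d) n is (l, c) :: w' then
    if c == f s then (l.+1, c) :: w' else (1%N, f s) :: rle (s + d) n
  else [:: (1%N, f s)].
Proof. by []. Qed.

Lemma rle_runs s n : runs f d s (rle s n) /\ total (rle s n) = n.
Proof.
elim: n s => [|n IH] s //; rewrite rle_cons; have := IH (s + d).
case: (rle (s + d) n) => [|[l c] w] [].
  move=> _ <-; split=> //; split=> // -[|] //; by rewrite mulr0n addr0.
move=> /= [l0 H Hw] e; case: eqP => [cE|cE] /=.
  split; last by rewrite -e.
  split=> // [[|i] il|]; first by rewrite mulr0n addr0.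
    by rewrite mulrS addrA H.
  by rewrite mulrS addrA.
split; last by rewrite -e.
rewrite mulr1n; split=> // -[|//] _; by rewrite mulr0n addr0.
Qed.

Lemma rle_head s n : exists w' : seq nat, unzip2 (rle s n.+1) = f s :: w'.
Proof.
rewrite rle_cons; case: (rle (s + d) n) => [|[l c] w].
  by exists [::].
by case: eqP => [->|_]; eexists.
Qed.

Lemma rle_sorted s n : sorted (fun a b => a != b) (unzip2 (rle s n)).
Proof.
elim: n s => [|n IH] s //; rewrite rle_cons; have := IH (s + d).
case: (rle (s + d) n) => [|[l c] w] //=.
by case: eqP => //= /eqP ne ->; rewrite eq_sym ne.
Qed.

Lemma rle_last s n : last 0%N (unzip2 (rle s n.+1)) = f (s + d *+ n).
Proof.
elim: n s => [|n IH] s; first by rewrite mulr0n addr0.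
rewrite rle_cons mulrS addrA -IH; have [w' e] := rle_head (s + d) n.
move: e; case: (rle (s + d) n.+1) => [|[l c] w] //= _.
by case: eqP.
Qed.

Lemma rle_count s n c : count_mem c (unzip2 (rle s n.+1)) =
  (\sum_(0 <= i < n) ((f (s + d *+ i)%R == c) && (f (s + d *+ i.+1)%R != c)) +
   (f (s + d *+ n)%R == c))%N.
Proof.
elim: n s => [|n IH] s; first by rewrite big_nil mulr0n addr0 /= addn0.
rewrite rle_cons big_nat_recl // mulr0n addr0 mulr1n (mulrS d n) (addrA s).
under eq_bigr => i _ do rewrite !(mulrS d i) !(mulrS d i.+1) !addrA.
move: (IH (s + d)); have [w' e] := rle_head (s + d) n; move: e.
case: (rle (s + d) n.+1) => [|[l x] w] //= [-> _].
rewrite -addnA => <-; case: eqP => [->|/eqP ne] /=.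
  by case: eqP.
congr (_ + _)%N; case: eqP => //= e; rewrite -e; move: ne; rewrite e.
by case: eqP.
Qed.

Lemma exists_runs : (exists x, f x != f (x + d)) ->
  exists s w, [/\ runs f d s w, total w = #|V|,
    path.cycle (fun a b => a != b) (unzip2 w) &
    forall c, count_mem c (unzip2 w) = exits d [set x | f x == c]].
Proof.
(* Starting just after a change of color makes the first and last runs differ in color, so that the
   linear encoding closes up to a cyclic word. *)
move=> [x xd]; pose s := x + d; pose n := #|V|.-1.
have nE : n.+1 = #|V| by rewrite prednK // prime_gt0.
have sn : s + d *+ n = x by rewrite /s -addrA -mulrS nE mulrn_card addr0.
exists s, (rle s #|V|); have [h1 h2] := rle_runs s #|V|; split=> //.
  have := rle_sorted s #|V|; have := rle_last s n; have := rle_head s n.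
  rewrite -nE sn; case=> w' -> /= e; rewrite rcons_path => -> /=.
  by rewrite (last_nth 0%N) /= in e *; rewrite e.
move=> c; rewrite -{1}nE rle_count /exits -sum1_card.
pose h y := (f y == c) && (f (y + d) != c).
have hx : (f (s + d *+ n)%R == c) = h (s + d *+ n).
  rewrite sn /h; case: eqP => //= <-; by rewrite eq_sym xd.
have -> : (\sum_(0 <= i < n)
    ((f (s + d *+ i)%R == c) && (f (s + d *+ i.+1)%R != c)) =
    \sum_(0 <= i < n) h (s + d *+ i)%R)%N.
  by apply: eq_bigr => i _; rewrite /h mulrSr addrA.
rewrite hx -(big_nat_recr n 0%N (fun i => nat_of_bool (h (s + d *+ i)))) //=.
rewrite nE big_mkord.
pose g (i : 'I_#|V|) := s + d *+ i.
have g_inj : injective g.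
  move=> i j /addrI /(mulrn_inj V_prime d0 (ltn_ord i) (ltn_ord j)).
  exact: val_inj.
have g_bij : bijective g by apply: inj_card_bij g_inj _; rewrite card_ord.
rewrite [RHS]big_mkcond /= (reindex g) /=; last exact: onW_bij.
by apply: eq_bigr => i _; rewrite !inE /h; case: (_ && _).
Qed.

End Runs.

(** * Cyclic words in three colors *)

Definition distinct_colors (a b c : nat) : bool :=
  [&& a != b, a != c, b != c, (a < 3)%N, (b < 3)%N & (c < 3)%N].

Definition color_words (m : nat) : seq (seq nat) :=
  iter m (fun L => flatten [seq [seq x :: w | x <- iota 0 3] | w <- L])
    [:: [::]].

Definition color_triples : seq (nat * nat * nat) :=
  [:: (0, 1, 2); (0, 2, 1); (1, 0, 2); (1, 2, 0); (2, 0, 1); (2, 1, 0)]%N.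

Lemma mem_color_words w : all (fun c => (c < 3)%N) w -> w \in color_words (size w).
Proof.
elim: w => //= c w IH /andP[c3 /IH wL].
apply/flattenP; exists [seq x :: w | x <- iota 0 3]; first exact: map_f.
by apply: map_f; rewrite mem_iota.
Qed.

Lemma color_triplesP t : t \in color_triples -> distinct_colors t.1.1 t.1.2 t.2.
Proof. by move: t; apply/allP. Qed.

Lemma color_triplesE a b c : distinct_colors a b c -> (a, b, c) \in color_triples.
Proof.
case/and5P=> ab ac bc a3 /andP[b3 c3].
by move: a b c ab ac bc a3 b3 c3 => [|[|[|?]]] [|[|[|?]]] [|[|[|?]]].
Qed.

Lemma size_count w : all (fun c => (c < 3)%N) w ->
  size w = (count_mem 0%N w + count_mem 1%N w + count_mem 2%N w)%N.
Proof. by elim: w => //= c w IH /andP[c3 /IH ->]; move: c c3 => [|[|[|?]]] //=; lia. Qed.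

Definition rotates_to (pat : nat -> nat -> nat -> seq nat) (w : seq nat) :=
  has (fun r => has (fun t => seq.rot r w == pat t.1.1 t.1.2 t.2) color_triples)
    (iota 0 (size w)).

Lemma rotates_toP pat w : rotates_to pat w ->
  exists r x y z, distinct_colors x y z /\ seq.rot r w = pat x y z.
Proof.
case/hasP=> r _ /hasP[[[x y] z] /color_triplesP xyz /eqP e].
by exists r, x, y, z.
Qed.

(** The counts force the length, which leaves finitely many words. Since [a], [b], [c] are
    variables, the check ranges over [color_triples] instead, so that it is closed and [vm_compute]
    can settle it. *)
Lemma color_words_check a b c na nb nc w pats : distinct_colors a b c ->
    all (fun c => (c < 3)%N) w ->
    path.cycle (fun a b => a != b) w ->
    count_mem a w = na -> count_mem b w = nb -> count_mem c w = nc ->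
    all (fun w => path.cycle (fun a b => a != b) w ==>
      has (fun t => [&& count_mem t.1.1 w == na, count_mem t.1.2 w == nb &
                    count_mem t.2 w == nc]) color_triples ==>
      has (fun pat => rotates_to pat w) pats) (color_words (na + nb + nc)) ->
  has (fun pat => rotates_to pat w) pats.
Proof.
move=> abc w3 cw ea eb ec /allP chk.
have /chk : w \in color_words (na + nb + nc).
  suff <- : size w = (na + nb + nc)%N by apply: mem_color_words.
  rewrite size_count // -ea -eb -ec; move: abc.
  move=> /color_triplesE; rewrite !inE => /or4P[||| /orP[|/orP[]]] /eqP[-> -> ->]; lia.
rewrite cw implyTb => /implyP; apply; apply/hasP; exists (a, b, c).
  exact: color_triplesE.
by rewrite /= ea eb ec !eqxx.
Qed.

Lemma word_211 a b c w : distinct_colors a b c ->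
    all (fun c => (c < 3)%N) w -> path.cycle (fun a b => a != b) w ->
    count_mem a w = 2%N -> count_mem b w = 1%N -> count_mem c w = 1%N ->
  exists r x y z, distinct_colors x y z /\ seq.rot r w = [:: x; y; x; z].
Proof.
move=> abc w3 cw ea eb ec.
suff : rotates_to (fun x y z => [:: x; y; x; z]) w by exact: rotates_toP.
suff : has (fun pat => rotates_to pat w) [:: fun x y z => [:: x; y; x; z]].
  by rewrite /= orbF.
by apply: (color_words_check abc w3 cw ea eb ec); vm_compute.
Qed.

Lemma word_222 w :
    all (fun c => (c < 3)%N) w -> path.cycle (fun a b => a != b) w ->
    count_mem 0%N w = 2%N -> count_mem 1%N w = 2%N -> count_mem 2%N w = 2%N ->
  exists r x y z, distinct_colors x y z /\
    (seq.rot r w = [:: x; y; z; x; y; z] \/ seq.rot r w = [:: x; y; x; z; y; z]).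
Proof.
move=> w3 cw ea eb ec.
have : has (fun pat => rotates_to pat w)
  [:: fun x y z => [:: x; y; z; x; y; z]; fun x y z => [:: x; y; x; z; y; z]].
  by apply: (@color_words_check 0 1 2 _ _ _ _ _ isT w3 cw ea eb ec); vm_compute.
case/orP=> [/rotates_toP|].
  by move=> [r [x [y [z [xyz e]]]]]; exists r, x, y, z; split; [|left].
rewrite orbF => /rotates_toP[r [x [y [z [xyz e]]]]].
by exists r, x, y, z; split; [|right].
Qed.

Lemma word_322 a b c w : distinct_colors a b c ->
    all (fun c => (c < 3)%N) w -> path.cycle (fun a b => a != b) w ->
    count_mem a w = 3%N -> count_mem b w = 2%N -> count_mem c w = 2%N ->
  exists r x y z, distinct_colors x y z /\
    (seq.rot r w = [:: x; y; x; z; x; y; z] \/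
     seq.rot r w = [:: x; y; x; z; x; z; y]).
Proof.
move=> abc w3 cw ea eb ec.
have : has (fun pat => rotates_to pat w)
  [:: fun x y z => [:: x; y; x; z; x; y; z];
      fun x y z => [:: x; y; x; z; x; z; y]].
  by apply: (color_words_check abc w3 cw ea eb ec); vm_compute.
case/orP=> [/rotates_toP|].
  by move=> [r [x' [y [z [xyz e]]]]]; exists r, x', y, z; split; [|left].
rewrite orbF => /rotates_toP[r [x' [y [z [xyz e]]]]].
by exists r, x', y, z; split; [|right].
Qed.

(** * Classes with at least two elements are progressions *)

Ltac arith :=
  repeat match goal with H : ?P |- _ =>
    match type of P with Prop =>
      lazymatch P with
      | @eq nat _ _ => fail
      | is_true (leq _ _) => fail
      | _ => clear H
      end
    end
  end; lia.

Lemma distinct_colorsE a b c : distinct_colors a b c ->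
  [/\ a != b, a != c & b != c] /\ [/\ b != a, c != a & c != b] /\
  [/\ (a < 3)%N, (b < 3)%N & (c < 3)%N].
Proof.
by case/and5P=> ab ac bc a3 /andP[b3 c3]; split; [|split]; split; rewrite // eq_sym.
Qed.

Lemma distinct_colorsCA a b c : distinct_colors a b c = distinct_colors b a c.
Proof. by rewrite /distinct_colors; lia. Qed.

Lemma distinct_colorsAC a b c : distinct_colors a b c = distinct_colors a c b.
Proof. by rewrite /distinct_colors; lia. Qed.

(** The injections [g] and [h] absorb the dilations, translations and signs that arise when the
    equation is solved for one of its variables; since [C] is proper, the minimum in
    [cauchy_davenport] cannot be |V|. *)
Lemma cauchy_davenport_into (V : finZmodType) (X Y C : {set V}) (g h : V -> V) :
    prime #|V| -> (#|C| < #|V|)%N -> injective g -> injective h ->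
    X != set0 -> Y != set0 ->
    (forall x y, x \in X -> y \in Y -> g x + h y \in C) ->
  (#|X| + #|Y| <= #|C|.+1)%N.
Proof.
move=> V_prime CV g_inj h_inj X0 Y0 XYC.
have sC : sumset (g @: X) (h @: Y) \subset C.
  apply/subsetP=> _ /imset2P[_ _ /imsetP[x xX ->] /imsetP[y yY ->] ->].
  exact: XYC.
have := @cauchy_davenport V V_prime (g @: X) (h @: Y).
rewrite !imset_eq0 X0 Y0 !card_imset // => /(_ isT isT).
have := subset_leq_card sC; rewrite geq_min; lia.
Qed.

(** * Interval arithmetic for the sums of two classes with two runs each *)

(* [rs] lists disjoint index intervals (start, length) inside [T] from left
   to right between [t] and [u]. *)
Fixpoint intervals (T : pred nat) (t : nat) (rs : seq (nat * nat)) (u : nat) :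
    Prop :=
  if rs is (v, l) :: rs' then
    [/\ (t <= v)%N, forall i, (v <= i)%N -> (i < v + l)%N -> T i &
        intervals T (v + l)%N rs' u]
  else (t <= u)%N.

(* Indices of the sums of two classes [A] and [B], when going around the
   group one meets runs of lengths [a1], [b1], [c1], [a2], [b2], [c2] lying in
   [A], [B], [C], [A], [B], [C], and [A + B] has at most [#|A| + #|B|]
   elements. *)
Record two_block_sums (T : pred nat) (a1 b1 c1 a2 b2 c2 : nat) : Prop :=
  TwoBlockSums {
  tbs_a1 : (0 < a1)%N; tbs_b1 : (0 < b1)%N; tbs_c1 : (0 < c1)%N;
  tbs_a2 : (0 < a2)%N; tbs_b2 : (0 < b2)%N; tbs_c2 : (0 < c2)%N;
  tbs_11 : forall i, (a1 <= i)%N -> (i < a1 + a1 + b1 - 1)%N -> T i;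
  tbs_12 : forall i, (a1 + b1 + c1 + a2 <= i)%N ->
    (i < a1 + b1 + c1 + a2 + a1 + b2 - 1)%N -> T i;
  tbs_21 : forall i, (a1 + b1 + c1 + a1 <= i)%N ->
    (i < a1 + b1 + c1 + a1 + a2 + b1 - 1)%N -> T i;
  tbs_22 : forall i, (2 * (a1 + b1 + c1) + a2 <= i)%N ->
    (i < 2 * (a1 + b1 + c1) + a2 + a2 + b2 - 1)%N -> T i;
  tbs_period : forall i, T (i + (a1 + b1 + c1 + a2 + b2 + c2))%N = T i;
  tbs_card : forall t rs,
    intervals T t rs (t + (a1 + b1 + c1 + a2 + b2 + c2))%N ->
    (sumn (unzip2 rs) <= a1 + a2 + (b1 + b2))%N
}.

(** For larger [a1] the sums A1 + B1 and A1 + B2 join to an interval of length [L]; the bound on |A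
    + B| then forces [c1 = 1] and leaves no other sum in a period. The sums A2 + B1 and A2 + B2 must
    fit inside, which gives [b1 <= b2] and [b2 + c2 <= b1 + 1], hence [c2 = 1], against
    [2 < c1 + c2]. *)
Lemma two_block_unbalanced_a T a1 b1 c1 a2 b2 c2 :
    two_block_sums T a1 b1 c1 a2 b2 c2 -> (2 < c1 + c2)%N ->
  (a1 <= a2 + c1 + 1)%N.
Proof.
case=> a1p b1p c1p a2p b2p c2p T11 T12 T21 T22 per card c3.
rewrite leqNgt; apply/negP=> big.
pose e := (a1 + b1 + c1)%N; pose L := (e + a2 + b2 - 1)%N.
have TL i : (a1 <= i)%N -> (i < a1 + L)%N -> T i.
  move=> i1 i2; case: (ltnP i (a1 + a1 + b1 - 1)) => h; first exact: T11.
  by apply: T12; rewrite /L /e in i2; arith.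
have c1E : c1 = 1%N.
  have /= := card a1 [:: (a1, L)]; rewrite addn0 => H.
  have : (L <= a1 + a2 + (b1 + b2))%N by apply: H; split=> //; rewrite /L /e; arith.
  by rewrite /L /e; arith.
have out i : (a1 + L <= i)%N -> (i < a1 + (e + a2 + b2 + c2))%N -> ~~ T i.
  move=> i1 i2; apply/negP=> Ti.
  have /= := card a1 [:: (a1, L); (i, 1%N)]; rewrite addn0 => H.
  have : (L + 1 <= a1 + a2 + (b1 + b2))%N.
    apply: H; split=> //; split=> //; last by rewrite /e in i2; arith.
    by move=> j j1 j2; have -> : j = i by arith.
  by rewrite /L /e; arith.
have b12 : (b1 <= b2)%N.
  rewrite leqNgt; apply/negP=> lt.
  have /negP[] : ~~ T (a1 + L)%N by apply: out; rewrite /L /e; arith.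
  by apply: T21; rewrite /L /e; arith.
have bc : (b2 + c2 <= b1 + 1)%N.
  rewrite leqNgt; apply/negP=> lt.
  have /negP[] : ~~ T (maxn (2 * e + a2) (a1 + L)).
    by apply: out; rewrite /L /e; arith.
  by apply: T22; rewrite /L /e; arith.
arith.
Qed.

(** The mirror image of [two_block_unbalanced_a]: reading the cyclic word backwards exchanges the
    two summands, so that [b2] plays the part of [a1]. *)
Lemma two_block_unbalanced_b T a1 b1 c1 a2 b2 c2 :
    two_block_sums T a1 b1 c1 a2 b2 c2 -> (2 < c1 + c2)%N ->
  (b2 <= b1 + c1 + 1)%N.
Proof.
case=> a1p b1p c1p a2p b2p c2p T11 T12 T21 T22 per card c3.
rewrite leqNgt; apply/negP=> big.
pose e := (a1 + b1 + c1)%N; pose L := (e + a2 + b2 - 1)%N.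
pose q := (a1 + b1 + c1 + a2 + b2 + c2)%N.
have TL i : (e + a2 <= i)%N -> (i < e + a2 + L)%N -> T i.
  move=> i1 i2; case: (ltnP i (e + a2 + a1 + b2 - 1)) => h; first exact: T12.
  by apply: T22; rewrite /L /e in h i1 i2; arith.
have c1E : c1 = 1%N.
  have /= := card (e + a2)%N [:: (e + a2, L)%N]; rewrite addn0 => H.
  have : (L <= a1 + a2 + (b1 + b2))%N by apply: H; split=> //; rewrite /L /e; arith.
  by rewrite /L /e; arith.
have out i : (e + a2 + L <= i)%N -> (i < e + a2 + q)%N -> ~~ T i.
  move=> i1 i2; apply/negP=> Ti.
  have /= := card (e + a2)%N [:: (e + a2, L); (i, 1)]%N; rewrite addn0 => H.
  have : (L + 1 <= a1 + a2 + (b1 + b2))%N.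
    apply: H; split=> //; split=> //; last by rewrite /e /q in i2 *; arith.
    by move=> j j1 j2; have -> : j = i by arith.
  by rewrite /L /e; arith.
have a21 : (a2 <= a1)%N.
  rewrite leqNgt; apply/negP=> lt.
  have /negP[] : ~~ T (e + a2 - 1 + q)%N by apply: out; rewrite /L /e /q; arith.
  by rewrite per; apply: T21; rewrite /e; arith.
have ac : (c2 + a1 <= a2 + 1)%N.
  rewrite leqNgt; apply/negP=> lt.
  have /negP[] : ~~ T (maxn a1 (e + a2 + L - q) + q)%N.
    by apply: out; rewrite /L /e /q; arith.
  by rewrite per; apply: T11; rewrite /L /e /q; arith.
arith.
Qed.

(** A1 + B2 and A2 + B1 always overlap, in a union of length max a + max b - 1, and the four balance
    hypotheses keep it apart from A1 + B1 and A2 + B2. If these two were disjoint as well, the total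
    would exceed |A| + |B|; so they overlap, and the length allowed to their union gives both
    inequalities. *)
Lemma two_block_aligned T a1 b1 c1 a2 b2 c2 :
    two_block_sums T a1 b1 c1 a2 b2 c2 -> (2 < a1 + a2)%N -> (2 < b1 + b2)%N ->
    (a1 <= a2 + c1 + 1)%N -> (a2 <= a1 + c2 + 1)%N ->
    (b1 <= b2 + c2 + 1)%N -> (b2 <= b1 + c1 + 1)%N ->
  (2 * (b1 + c1 + a2) <= (a1 + b1 + c1 + a2 + b2 + c2) + 2)%N /\
  (a1 + b1 + c1 + a2 + b2 + c2 <= 2 * (b1 + c1 + a2) + 2)%N.
Proof.
case=> a1p b1p c1p a2p b2p c2p T11 T12 T21 T22 per card a3 b3 h1 h2 h3 h4.
pose e := (a1 + b1 + c1)%N; pose q := (e + a2 + b2 + c2)%N.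
pose u := (e + minn a1 a2)%N; pose l := (a1 + a2 + maxn b1 b2 - 1 - minn a1 a2)%N.
have Tu i : (u <= i)%N -> (i < u + l)%N -> T i.
  rewrite /u /l => i1 i2.
  have [] : ((e + a2 <= i) && (i < e + a2 + a1 + b2 - 1) \/
             (e + a1 <= i) && (i < e + a1 + a2 + b1 - 1))%N by arith.
    by case/andP; exact: T12.
  by case/andP; exact: T21.
have T11' i : (a1 + q <= i)%N -> (i < a1 + q + (a1 + b1 - 1))%N -> T i.
  move=> i1 i2; have <- : (i - q + (a1 + b1 + c1 + a2 + b2 + c2))%N = i.
    by rewrite -/e -/q subnK //; arith.
  by rewrite per; apply: T11; arith.
have T22' i : (2 * e + a2 <= i)%N -> (i < 2 * e + a2 + (a2 + b2 - 1))%N -> T i.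
  by move=> i1 i2; apply: T22; rewrite -/e; arith.
have disj : ~ (a1 + q + (a1 + b1 - 1) <= 2 * e + a2)%N.
  move=> le; have /= := card u [:: (u, l); (a1 + q, a1 + b1 - 1);
    (2 * e + a2, a2 + b2 - 1)]%N.
  move=> H; suff /H : [/\ u <= u, forall i, u <= i -> i < u + l -> T i &
    [/\ u + l <= a1 + q, forall i, a1 + q <= i -> i < a1 + q + (a1 + b1 - 1) -> T i &
    [/\ a1 + q + (a1 + b1 - 1) <= 2 * e + a2,
      forall i, 2 * e + a2 <= i -> i < 2 * e + a2 + (a2 + b2 - 1) -> T i &
      2 * e + a2 + (a2 + b2 - 1) <= u + (a1 + b1 + c1 + a2 + b2 + c2)]]]%N.
    by rewrite /u /l /e /q in le *; arith.
  by split=> //; split=> //; [|split=> //]; rewrite /u /l /q /e in le *; arith.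
have disj' : ~ (2 * e + a2 + (a2 + b2 - 1) <= a1 + q)%N.
  move=> le; have /= := card u [:: (u, l); (2 * e + a2, a2 + b2 - 1);
    (a1 + q, a1 + b1 - 1)]%N.
  move=> H; suff /H : [/\ u <= u, forall i, u <= i -> i < u + l -> T i &
    [/\ u + l <= 2 * e + a2,
      forall i, 2 * e + a2 <= i -> i < 2 * e + a2 + (a2 + b2 - 1) -> T i &
    [/\ 2 * e + a2 + (a2 + b2 - 1) <= a1 + q,
      forall i, a1 + q <= i -> i < a1 + q + (a1 + b1 - 1) -> T i &
      a1 + q + (a1 + b1 - 1) <= u + (a1 + b1 + c1 + a2 + b2 + c2)]]]%N.
    by rewrite /u /l /e /q in le *; arith.
  by split=> //; split=> //; [|split=> //]; rewrite /u /l /q /e in le *; arith.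
pose v := minn (a1 + q) (2 * e + a2).
pose m := (maxn (a1 + q + (a1 + b1 - 1)) (2 * e + a2 + (a2 + b2 - 1)) - v)%N.
have Tv i : (v <= i)%N -> (i < v + m)%N -> T i.
  rewrite /v /m => i1 i2.
  have [] : ((a1 + q <= i) && (i < a1 + q + (a1 + b1 - 1)) \/
      (2 * e + a2 <= i) && (i < 2 * e + a2 + (a2 + b2 - 1)))%N by clear -i1 i2 disj disj'; lia.
    by case/andP; exact: T11'.
  by case/andP; exact: T22'.
have vm : (v + m = maxn (a1 + q + (a1 + b1 - 1)) (2 * e + a2 + (a2 + b2 - 1)))%N.
  by rewrite subnKC // leq_max geq_min leq_addr.
have /= := card u [:: (u, l); (v, m)].
move=> H; suff /H : [/\ u <= u, forall i, u <= i -> i < u + l -> T i &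
    [/\ u + l <= v, forall i, v <= i -> i < v + m -> T i &
      v + m <= u + (a1 + b1 + c1 + a2 + b2 + c2)]]%N.
  have : [/\ v <= a1 + q & v <= 2 * e + a2]%N by rewrite !geq_min !leqnn orbT.
  have : [/\ a1 + q + (a1 + b1 - 1) <= v + m &
    2 * e + a2 + (a2 + b2 - 1) <= v + m]%N by rewrite vm !leq_max !leqnn orbT.
  move=> [m1 m2] [v1 v2]; rewrite /l /q /e in m1 m2 v1 v2 *; arith.
split=> //; split=> //.
  by rewrite leq_min; apply/andP; split; rewrite /u /l /q /e; arith.
by rewrite vm geq_max; apply/andP; split; rewrite /u /q /e; arith.
Qed.

Lemma two_block_half T T' a1 b1 c1 a2 b2 c2 :
    two_block_sums T a1 b1 c1 a2 b2 c2 -> two_block_sums T' a2 b2 c2 a1 b1 c1 ->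
    (2 < a1 + a2)%N -> (2 < b1 + b2)%N -> (2 < c1 + c2)%N ->
  (2 * (b1 + c1 + a2) <= (a1 + b1 + c1 + a2 + b2 + c2) + 2)%N /\
  (a1 + b1 + c1 + a2 + b2 + c2 <= 2 * (b1 + c1 + a2) + 2)%N.
Proof.
move=> H H' a3 b3 c3; have c3' : (2 < c2 + c1)%N by rewrite addnC.
apply: (two_block_aligned H a3 b3).
- exact: two_block_unbalanced_a H c3.
- exact: two_block_unbalanced_a H' c3'.
- exact: two_block_unbalanced_b H' c3'.
- exact: two_block_unbalanced_b H c3.
Qed.

Section Coloring.

Variables (F : finFieldType) (k : F) (f : F -> nat).
Hypothesis F_prime : prime #|F|.
Hypothesis k0 : k != 0.
Hypothesis f3 : forall x, (f x < 3)%N.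
Hypothesis rf : forall x y z, x + y = k * z ->
  [|| f x == f y, f x == f z | f y == f z].
Implicit Types (x y z d : F) (a b c : nat).

(** * Colors forced by a change of color *)

Definition color_class c : {set F} := [set x | f x == c].
Definition ends c d : nat := exits d (color_class c).
Definition boundary a b d : {set F} :=
  [set x | (f x == a) && (f (x + d) == b) || (f x == b) && (f (x + d) == a)].
Definition inner c d : {set F} := [set x | (f x == c) && (f (x + d) == c)].

Lemma three_colors a b c x : distinct_colors a b c ->
  [|| f x == a, f x == b | f x == c].
Proof.
by move/color_triplesE; move: (f x) (f3 x) => [|[|[|?]]] // _; rewrite !inE;
  do ![case/orP] => /eqP[-> -> ->].
Qed.

Lemma sum_color x y a b : f x = a -> f y = b -> a != b ->
  (f ((x + y) / k) == a) || (f ((x + y) / k) == b).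
Proof.
move=> <- <- ne; have := @rf x y ((x + y) / k).
rewrite mulrC divfK // (negPf ne) /= => /(_ erefl).
by rewrite (eq_sym (f x)) (eq_sym (f y)).
Qed.

(** The same element comes from a [c]-[b] pair and from a [c]-[a] pair, and [c] is the only color
    that both allow. *)
Lemma sum_double_color p p' x x' a b c : distinct_colors a b c ->
  f p = c -> f p' = c -> f x = a -> f x' = b -> p + x' = p' + x ->
  f ((p + x') / k) = c.
Proof.
move=> /distinct_colorsE[[ab ac bc] [[ba ca cb] _]] fp fp' fx fx' e.
have := sum_color fp fx' cb; have := sum_color fp' fx ca; rewrite -e.
by case/orP=> /eqP -> //; rewrite (negPf ac) (negPf ab).
Qed.

Lemma diff_color x z a b y : f x = a -> f z = b -> a != b -> x + y = k * z ->
  (f y == a) || (f y == b).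
Proof.
move=> <- <- ne /rf; rewrite (negPf ne) /=.
by rewrite (eq_sym (f x)).
Qed.

Lemma diff_double_color p p' x x' a b c y : distinct_colors a b c ->
  f p = c -> f p' = c -> f x = a -> f x' = b ->
  x + y = k * p -> x' + y = k * p' -> f y = c.
Proof.
move=> /distinct_colorsE[[ab ac bc] [[ba ca cb] _]] fp fp' fx fx' e e'.
have := diff_color fx fp ac e; have := diff_color fx' fp' bc e'.
by case/orP=> /eqP -> //; rewrite (negPf ba) (negPf bc).
Qed.

Lemma diff_double_color' p p' x x' a b c y : distinct_colors a b c ->
  f p = c -> f p' = c -> f x = a -> f x' = b ->
  p + y = k * x -> p' + y = k * x' -> f y = c.
Proof.
move=> /distinct_colorsE[[ab ac bc] [[ba ca cb] _]] fp fp' fx fx' e e'.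
have := diff_color fp fx ca e; have := diff_color fp' fx' cb e'.
by case/orP=> /eqP -> //; rewrite (negPf ba) (negPf bc).
Qed.

(** Pairing [x], [x + d] with the color change before [y] puts [(x + y) / k] into class [a];
    exchanging the two points puts it into class [b]. *)
Lemma no_common_predecessor a b c d x y : distinct_colors a b c ->
  f x = a -> f (x + d) = a -> f (x - d) = c ->
  f y = b -> f (y + d) = b -> f (y - d) = c -> False.
Proof.
move=> abc fx fxd fx' fy fyd fy'.
have ha : f ((x + y) / k) = a.
  apply: (@sum_double_color x (x + d) (y - d) y c b a) => //.
    by rewrite distinct_colorsAC distinct_colorsCA distinct_colorsAC.
  by rewrite addrACA subrr addr0.
have hb : f ((y + x) / k) = b.
  apply: (@sum_double_color y (y + d) (x - d) x c a b) => //.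
    by rewrite distinct_colorsCA distinct_colorsAC.
  by rewrite addrACA subrr addr0.
move: hb; rewrite addrC ha => ab.
by have [[]] := distinct_colorsE abc; rewrite ab eqxx.
Qed.

Lemma no_common_successor a b c d x y : distinct_colors a b c ->
  f x = a -> f (x - d) = a -> f (x + d) = c ->
  f y = b -> f (y - d) = b -> f (y + d) = c -> False.
Proof.
move=> abc fx fxd fx' fy fyd fy'.
by apply: (@no_common_predecessor a b c (- d) x y abc); rewrite ?opprK.
Qed.

Lemma card_inner c d : (#|inner c d| + ends c d)%N = #|color_class c|.
Proof.
rewrite /ends -(card_setI_shift (- d) (color_class c)) exitsN; congr (_ + _)%N.
by apply: eq_card => x; rewrite !inE opprK.
Qed.

Lemma boundaryC a b d : boundary a b d = boundary b a d.
Proof. by apply/setP=> x; rewrite !inE orbC. Qed.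

Definition steps a b d : {set F} := [set x | (f x == a) && (f (x + d) == b)].

Lemma card_boundary a b d : a != b ->
  #|boundary a b d| = (#|steps a b d| + #|steps b a d|)%N.
Proof.
move=> ab; rewrite -cardsUI (_ : _ :&: _ = set0) ?cards0 ?addn0.
  by apply: eq_card => x; rewrite !inE.
apply/setP=> x; rewrite !inE; apply/negP=> /andP[/andP[/eqP-> _] /andP[]].
by rewrite (negPf ab).
Qed.

(** Around the cycle, class [a] is entered as often as it is left, and every passage crosses to or
    from [b] or [c]. *)
Lemma ends_boundary a b c d : distinct_colors a b c ->
  (2 * ends a d = #|boundary a b d| + #|boundary a c d|)%N.
Proof.
move=> abc; have [[ab ac bc] _] := distinct_colorsE abc.
rewrite !card_boundary //.
have out : ends a d = (#|steps a b d| + #|steps a c d|)%N.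
  rewrite -[RHS]cardsUI (_ : _ :&: _ = set0) ?cards0 ?addn0.
    apply: eq_card => x; rewrite !inE; case: eqP => //= _.
    case/or3P: (three_colors (x + d) abc) => /eqP ->;
    by rewrite !(eqxx, negPf ab, negPf ac, negPf bc, eq_sym _ a, eq_sym c).
  apply/setP=> x; rewrite !inE; apply/negP=> /andP[/andP[_ /eqP->] /andP[_]].
  by rewrite (negPf bc).
have inn : ends a d = (#|steps b a d| + #|steps c a d|)%N.
  have -> : ends a d =
      #|shift (- d) [set x in color_class a | x - d \notin color_class a]|.
    by rewrite card_shift /ends -exitsN.
  rewrite -[RHS]cardsUI.
  rewrite (_ : _ :&: _ = set0) ?cards0 ?addn0.
    apply: eq_card => x; rewrite !inE opprK addrK andbC.
    case: (f (x + d) == a); rewrite ?andbF //= !andbT.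
    case/or3P: (three_colors x abc) => /eqP ->;
    by rewrite !(eqxx, negPf ab, negPf ac, negPf bc, eq_sym _ a, eq_sym c).
  apply/setP=> x; rewrite !inE; apply/negP=> /andP[/andP[/eqP-> _] /andP[]].
  by rewrite (negPf bc).
by rewrite mul2n -addnn {1}out inn; lia.
Qed.

Lemma color_class_lt c : (exists x, f x != c) -> (#|color_class c| < #|F|)%N.
Proof.
move=> [x xc]; rewrite -[X in (_ < X)%N]cardsT; apply: proper_card.
by apply/properP; split; [apply: subsetT|exists x; rewrite !inE].
Qed.

(* [k * C] contains the sums of [inner c d + d] and [boundary a b d]; the next
   two lemmas follow from similar inclusions. *)
Lemma boundary_le a b c d : distinct_colors a b c -> (0 < #|inner c d|)%N ->
  (#|boundary a b d| <= (ends c d).+1)%N.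
Proof.
move=> abc; have [[ab ac bc] _] := distinct_colorsE abc.
have bac : distinct_colors b a c by rewrite distinct_colorsCA.
rewrite card_gt0 => P0; case: (set_0Vmem (boundary a b d)) => [->|[x xQ]].
  by rewrite cards0.
have C_lt : (#|color_class c| < #|F|)%N.
  apply: color_class_lt; exists x; move: xQ; rewrite inE.
  by case/orP=> /andP[/eqP-> _].
have := @cauchy_davenport_into _ (inner c d) (boundary a b d) (color_class c)
  (fun p => (p + d) / k) (fun x => x / k) F_prime C_lt _ _ P0 _.
have kV0 : k^-1 != 0 by rewrite invr_eq0.
have inj1 : injective (fun p => (p + d) / k) by move=> y z /(mulIf kV0) /addIr.
have inj2 : injective (fun p => p / k) by move=> y z /(mulIf kV0).
have Q0 : boundary a b d != set0 by apply/set0Pn; exists x.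
move/(_ inj1 inj2 Q0); rewrite -(card_inner c d).
suff H p y : p \in inner c d -> y \in boundary a b d ->
    (p + d) / k + y / k \in color_class c.
  by move/(_ H); rewrite -addnS leq_add2l.
rewrite !inE -mulrDl => /andP[/eqP fp /eqP fpd].
have e : p + (y + d) = (p + d) + y by rewrite addrA addrAC.
case/orP=> /andP[/eqP fy /eqP fyd]; apply/eqP; rewrite -e.
  exact: sum_double_color abc fp fpd fy fyd e.
exact: sum_double_color bac fp fpd fy fyd e.
Qed.

Lemma boundary_le_mul a b c d : distinct_colors a b c ->
  (0 < #|inner c d|)%N -> (#|boundary a b (k * d)%R| <= (ends c d).+1)%N.
Proof.
move=> abc; have [[ab ac bc] _] := distinct_colorsE abc.
have bac : distinct_colors b a c by rewrite distinct_colorsCA.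
rewrite card_gt0 => P0; case: (set_0Vmem (boundary a b (k * d))) => [->|[x xQ]].
  by rewrite cards0.
have C_lt : (#|color_class c| < #|F|)%N.
  apply: color_class_lt; exists x; move: xQ; rewrite inE.
  by case/orP=> /andP[/eqP-> _].
have := @cauchy_davenport_into _ (inner c d) (boundary a b (k * d))
  (color_class c) (fun p => k * p) -%R F_prime C_lt (mulfI k0) oppr_inj P0.
have Q0 : boundary a b (k * d) != set0 by apply/set0Pn; exists x.
move/(_ Q0); rewrite -(card_inner c d).
suff H p y : p \in inner c d -> y \in boundary a b (k * d) ->
    k * p + - y \in color_class c.
  by move/(_ H); rewrite -addnS leq_add2l.
rewrite !inE => /andP[/eqP fp /eqP fpd].
have e : y + (k * p - y) = k * p by rewrite addrC subrK.
have e' : (y + k * d) + (k * p - y) = k * (p + d). by ring.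
case/orP=> /andP[/eqP fy /eqP fyd]; apply/eqP.
  exact: diff_double_color abc fp fpd fy fyd e e'.
exact: diff_double_color bac fp fpd fy fyd e e'.
Qed.

Lemma boundary_le_div a b c d : distinct_colors a b c ->
  (0 < #|inner c (k * d)%R|)%N -> (#|boundary a b d| <= (ends c (k * d)%R).+1)%N.
Proof.
move=> abc; have [[ab ac bc] _] := distinct_colorsE abc.
have bac : distinct_colors b a c by rewrite distinct_colorsCA.
rewrite card_gt0 => P0; case: (set_0Vmem (boundary a b d)) => [->|[x xQ]].
  by rewrite cards0.
have C_lt : (#|color_class c| < #|F|)%N.
  apply: color_class_lt; exists x; move: xQ; rewrite inE.
  by case/orP=> /andP[/eqP-> _].
have := @cauchy_davenport_into _ (inner c (k * d)) (boundary a b d)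
  (color_class c) -%R (fun p => k * p) F_prime C_lt oppr_inj (mulfI k0) P0.
have Q0 : boundary a b d != set0 by apply/set0Pn; exists x.
move/(_ Q0); rewrite -(card_inner c (k * d)).
suff H p y : p \in inner c (k * d) -> y \in boundary a b d ->
    - p + k * y \in color_class c.
  by move/(_ H); rewrite -addnS leq_add2l.
rewrite !inE => /andP[/eqP fp /eqP fpd].
have e : p + (- p + k * y) = k * y by rewrite addNKr.
have e' : (p + k * d) + (- p + k * y) = k * (y + d). by ring.
case/orP=> /andP[/eqP fy /eqP fyd]; apply/eqP.
  exact: diff_double_color' abc fp fpd fy fyd e e'.
exact: diff_double_color' bac fp fpd fy fyd e e'.
Qed.

Lemma ends_gt0 c d : d != 0 -> (0 < #|color_class c|)%N ->
  (exists x, f x != c) -> (0 < ends c d)%N.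
Proof.
move=> d0 C0 [x xc]; rewrite lt0n; apply/eqP=> e.
have := card_setI_shift d (color_class c); rewrite -/(ends c d) e addn0 => eI.
have sC : shift d (color_class c) = color_class c.
  have /setIidPl sI : color_class c :&: shift d (color_class c) = color_class c.
    by apply/eqP; rewrite eqEcard subsetIl eI leqnn.
  by apply/esym/eqP; rewrite eqEcard sI card_shift leqnn.
case: (shift_invariant F_prime d0 sC) => e'.
  by rewrite e' cards0 in C0.
by have := in_setT x; rewrite -e' inE (negPf xc).
Qed.

(** * Reading colors, class sizes and clashes off a word of runs *)

Lemma runs_nth d s w w1 l c w2 i : runs f d s w -> w = w1 ++ (l, c) :: w2 ->
  (total w1 <= i)%N -> (i < total w1 + l)%N -> f (s + d *+ i) = c.
Proof.
move=> + ew; rewrite ew runs_cat => -[_ [_ H _]] le_i lt_i.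
by rewrite -(subnKC le_i) mulrnDr addrA H // ltn_subLR.
Qed.

Lemma runs_card d s w c : d != 0 -> runs f d s w -> total w = #|F| ->
  #|color_class c| = sumn [seq p.1 | p <- w & p.2 == c].
Proof.
move=> d0 Rw ew.
have -> : #|color_class c| = (\sum_(0 <= i < #|F|) (f (s + d *+ i)%R == c))%N.
  rewrite -sum1_card big_mkord big_mkcond /=.
  have inj : injective (fun i : 'I_#|F| => s + d *+ i).
    move=> i j /addrI /(mulrn_inj F_prime d0 (ltn_ord i) (ltn_ord j)).
    exact: val_inj.
  have bij : bijective (fun i : 'I_#|F| => s + d *+ i).
    by apply: inj_card_bij inj _; rewrite card_ord.
  rewrite (reindex (fun i : 'I_#|F| => s + d *+ i)) /=; last exact: onW_bij.
  by apply: eq_bigr => i _; rewrite inE; case: eqP.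
rewrite -ew {ew}; elim: w s Rw => [|[l x] w IH] s /=.
  by rewrite /total /= big_nil.
move=> [l0 H /IH Rw]; rewrite /total /= -/(total w).
rewrite (big_cat_nat (n := l)) ?leq_addr //= -{2}[l]add0n big_addn addKn.
have -> : (\sum_(0 <= i < total w) (f (s + d *+ (i + l))%R == c))%N =
  sumn [seq p.1 | p <- w & p.2 == c].
  by rewrite -Rw; apply: eq_bigr => i _; rewrite addnC mulrnDr addrA.
have -> : (\sum_(0 <= i < l) (f (s + d *+ i)%R == c) = (x == c) * l)%N.
  rewrite (eq_big_nat _ _ (F2 := fun=> (x == c) : nat)).
    by rewrite sum_nat_const_nat subn0 mulnC.
  by move=> i /andP[_ il]; rewrite H.
by case: eqP => _ //=; rewrite mul1n.
Qed.

Lemma runs_double d s w : runs f d s w -> total w = #|F| -> runs f d s (w ++ w).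
Proof. by move=> Rw ew; rewrite runs_cat ew mulrn_card addr0. Qed.

Lemma runs_at d s w m : runs f d s w -> (m < size w)%N ->
  forall i, (total (take m w) <= i)%N ->
    (i < total (take m w) + (nth (0, 0) w m).1)%N ->
  f (s + d *+ i) = (nth (0, 0) w m).2.
Proof.
move=> Rw mw i; apply: (runs_nth Rw (w2 := drop m.+1 w)).
by rewrite -surjective_pairing -drop_nth // cat_take_drop.
Qed.

Lemma runs_gt0 d s w m : runs f d s w -> (m < size w)%N ->
  (0 < (nth (0, 0)%N w m).1)%N.
Proof.
elim: w s m => //= -[l c] w IH s [|m] [l0 _ Rw] //=; exact: IH Rw.
Qed.

Lemma total_take_succ w m : (m < size w)%N ->
  total (take m.+1 w) = (total (take m w) + (nth (0, 0)%N w m).1)%N.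
Proof.
move=> mw; rewrite (take_nth (0, 0)%N) // /total /unzip1 map_rcons -cats1.
by rewrite sumn_cat /= addn0.
Qed.

Lemma run_predecessor d s w m : runs f d s w -> (m.+1 < size w)%N ->
    (1 < (nth (0, 0)%N w m.+1).1)%N ->
  exists x, [/\ f x = (nth (0, 0)%N w m.+1).2,
    f (x + d) = (nth (0, 0)%N w m.+1).2 & f (x - d) = (nth (0, 0)%N w m).2].
Proof.
move=> Rw mw l2; have mw' := ltnW mw; have l1 := runs_gt0 Rw mw'.
have e := total_take_succ mw'; set t := total (take m.+1 w) in e.
exists (s + d *+ t); split.
- by apply: (runs_at Rw mw); rewrite -/t; lia.
- by rewrite -addrA -mulrSr; apply: (runs_at Rw mw); rewrite -/t; lia.
have -> : s + d *+ t - d = s + d *+ t.-1.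
  have -> : t = t.-1.+1 by lia.
  by rewrite mulrSr addrA addrK.
by apply: (runs_at Rw mw'); lia.
Qed.

Lemma run_successor d s w m : runs f d s w -> (m.+1 < size w)%N ->
    (1 < (nth (0, 0)%N w m).1)%N ->
  exists x, [/\ f x = (nth (0, 0)%N w m).2,
    f (x - d) = (nth (0, 0)%N w m).2 & f (x + d) = (nth (0, 0)%N w m.+1).2].
Proof.
move=> Rw mw l1; have mw' := ltnW mw; have l2 := runs_gt0 Rw mw.
have e := total_take_succ mw'; set t := total (take m.+1 w) in e.
have et : t = t.-2.+2 by lia.
exists (s + d *+ t.-2.+1); split.
- by apply: (runs_at Rw mw'); lia.
- by rewrite mulrSr addrA addrK; apply: (runs_at Rw mw'); lia.
by rewrite -addrA -mulrSr -et; apply: (runs_at Rw mw); rewrite -/t; lia.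
Qed.

Lemma predecessor_clash d s w i j : runs f d s w ->
    (i.+1 < size w)%N -> (j.+1 < size w)%N ->
    (nth (0, 0)%N w i).2 = (nth (0, 0)%N w j).2 ->
    distinct_colors (nth (0, 0)%N w i.+1).2 (nth (0, 0)%N w j.+1).2
      (nth (0, 0)%N w i).2 ->
  ((nth (0, 0)%N w i.+1).1 < 2)%N || ((nth (0, 0)%N w j.+1).1 < 2)%N.
Proof.
move=> Rw iw jw e abc; apply: contraT; rewrite negb_or -!leqNgt => /andP[li lj].
have [x [x1 x2 x3]] := run_predecessor Rw iw li.
have [y [y1 y2 y3]] := run_predecessor Rw jw lj.
rewrite -e in y3; have [] := no_common_predecessor abc x1 x2 x3 y1 y2 y3.
Qed.

Lemma successor_clash d s w i j : runs f d s w ->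
    (i.+1 < size w)%N -> (j.+1 < size w)%N ->
    (nth (0, 0)%N w i.+1).2 = (nth (0, 0)%N w j.+1).2 ->
    distinct_colors (nth (0, 0)%N w i).2 (nth (0, 0)%N w j).2
      (nth (0, 0)%N w i.+1).2 ->
  ((nth (0, 0)%N w i).1 < 2)%N || ((nth (0, 0)%N w j).1 < 2)%N.
Proof.
move=> Rw iw jw e abc; apply: contraT; rewrite negb_or -!leqNgt => /andP[li lj].
have [x [x1 x2 x3]] := run_successor Rw iw li.
have [y [y1 y2 y3]] := run_successor Rw jw lj.
rewrite -e in y3; have [] := no_common_successor abc x1 x2 x3 y1 y2 y3.
Qed.

Lemma color_word d c : d != 0 -> (0 < ends c d)%N ->
  exists w, [/\ all (fun c => (c < 3)%N) w, path.cycle (fun a b => a != b) w,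
    forall c, count_mem c w = ends c d &
    forall r, exists s rw, [/\ runs f d s rw, total rw = #|F| &
      unzip2 rw = seq.rot r w]].
Proof.
move=> d0 /card_gt0P[x]; rewrite !inE => /andP[/eqP fx fxd].
have [|s [w [Rw ew cw countw]]] := exists_runs F_prime d0 (f := f).
  by exists x; rewrite fx eq_sym.
exists (unzip2 w); split=> // [|r].
  elim: w s Rw {ew cw countw} => //= -[l y] w IH s [l0 H /IH ->] /=.
  by rewrite andbT -(H 0%N l0).
have [s' [Rw' ew']] := runs_rot r Rw ew.
by exists s', (seq.rot r w); rewrite /unzip2 map_rot.
Qed.

(** * Words that cannot occur, or that exhibit a progression *)

Lemma not_xyxz d (x y z : nat) : d != 0 -> distinct_colors x y z ->
    (1 < #|color_class y|)%N -> (1 < #|color_class z|)%N ->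
  forall s l1 l2 l3 l4, runs f d s [:: (l1, x); (l2, y); (l3, x); (l4, z)] ->
    total [:: (l1, x); (l2, y); (l3, x); (l4, z)] = #|F| -> False.
Proof.
move=> d0 xyz + + s l1 l2 l3 l4 R e; have [[xy xz yz] [[yx zx zy] _]] := distinct_colorsE xyz.
rewrite !(runs_card _ d0 R e) /= !(eqxx, negPf xy, negPf xz, negPf yz, negPf zy) /=.
have yzx : distinct_colors y z x by rewrite distinct_colorsAC distinct_colorsCA.
have := predecessor_clash (i := 0%N) (j := 2%N) R isT isT erefl yzx.
by rewrite /=; lia.
Qed.

Lemma no_211 d a b c : d != 0 -> distinct_colors a b c ->
    (forall e, (e < 3)%N -> (1 < #|color_class e|)%N) ->
  ends a d = 2%N -> ends b d = 1%N -> ends c d = 1%N -> False.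
Proof.
move=> d0 abc big ea eb ec.
have [|w [w3 cw countw rotw]] := @color_word d a d0; first by rewrite ea.
have [||| r [x [y [z [xyz er]]]]] := word_211 abc w3 cw; rewrite ?countw //.
have [s [rw [Rw ew]]] := rotw r; rewrite er.
move: rw Rw ew => [|[l1 ?] [|[l2 ?] [|[l3 ?] [|[l4 ?] [|? ?]]]]] //.
move=> Rw ew /= [? ? ? ?]; subst.
have [_ [_ [_ y3 z3]]] := distinct_colorsE xyz.
exact: not_xyxz d0 xyz (big _ y3) (big _ z3) _ _ _ _ _ Rw ew.
Qed.

(** With [ends c d = 1], the counts of [ends_boundary] give [ends a d + ends b d = #|boundary a b d|
    + 1], at most 3 by [boundary_le]. Both terms are positive, and [no_211] excludes the split into
    2 and 1. *)
Lemma all_progressions d a b c : d != 0 -> distinct_colors a b c ->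
    (forall e, (e < 3)%N -> (1 < #|color_class e|)%N) ->
  ends c d = 1%N -> ends a d = 1%N /\ ends b d = 1%N.
Proof.
move=> d0 abc big ec; have [[ab ac bc] [_ [a3 b3 c3]]] := distinct_colorsE abc.
have abc' : distinct_colors b a c by rewrite distinct_colorsCA.
have cab : distinct_colors c a b by rewrite distinct_colorsCA distinct_colorsAC.
have has_color (x : nat) : (x < 3)%N -> exists u, f u = x.
  by move/big/ltnW/card_gt0P=> [u]; rewrite inE => /eqP; exists u.
have pos (x y : nat) : (x < 3)%N -> (y < 3)%N -> x != y -> (0 < ends x d)%N.
  move=> x3 y3 xy; apply: (ends_gt0 d0); first exact/ltnW/big.
  by have [u eu] := has_color _ y3; exists u; rewrite eu eq_sym.
have inn : (0 < #|inner c d|)%N by have := card_inner c d; have := big c c3; lia.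
have := boundary_le abc inn; have := ends_boundary d abc.
have := ends_boundary d abc'; have := ends_boundary d cab.
rewrite (boundaryC b a) (boundaryC c a) (boundaryC c b) ec.
have := pos _ _ a3 c3 ac; have := pos _ _ b3 c3 bc.
have := no_211 d0 abc big; have := no_211 d0 abc' big; lia.
Qed.

(** Each color has a run of length at least two, and the six clashes together forbid every choice of
    one such run per color. The word is doubled so that clashes across its seam are seen. *)
Lemma not_xyxzyz d (x y z : nat) s l1 l2 l3 l4 l5 l6 :
    let w := [:: (l1, x); (l2, y); (l3, x); (l4, z); (l5, y); (l6, z)] in
    distinct_colors x y z -> (2 < l1 + l3)%N -> (2 < l2 + l5)%N ->
    (2 < l4 + l6)%N -> runs f d s w -> total w = #|F| -> False.
Proof.
move=> w; rewrite {}/w => xyz a3 b3 c3 R e; have R2 := runs_double R e.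
have yzx : distinct_colors y z x by rewrite distinct_colorsAC distinct_colorsCA.
have xzy : distinct_colors x z y by rewrite distinct_colorsAC.
have := predecessor_clash (i := 5) (j := 3) R2 isT isT erefl xyz.
have := predecessor_clash (i := 0) (j := 2) R2 isT isT erefl yzx.
have := predecessor_clash (i := 1) (j := 4) R2 isT isT erefl xzy.
have := successor_clash (i := 2) (j := 4) R2 isT isT erefl xyz.
have := successor_clash (i := 1) (j := 5) R2 isT isT erefl yzx.
have := successor_clash (i := 0) (j := 3) R2 isT isT erefl xzy.
by rewrite /=; lia.
Qed.

Lemma sum_along d s i j i' j' : (i + j = i' + j')%N ->
  (s + d *+ i) + (s + d *+ j) = (s + d *+ i') + (s + d *+ j').
Proof. by move=> e; rewrite addrACA -mulrnDr e mulrnDr addrACA. Qed.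

Lemma not_xyxzxyz d (x y z : nat) s l1 l2 l3 l4 l5 l6 l7 :
    let w := [:: (l1, x); (l2, y); (l3, x); (l4, z); (l5, x); (l6, y); (l7, z)] in
    distinct_colors x y z -> (2 < l2 + l6)%N -> (2 < l4 + l7)%N ->
    runs f d s w -> total w = #|F| -> False.
Proof.
move=> w; rewrite {}/w => xyz b3 c3 R e; have R2 := runs_double R e.
have yzx : distinct_colors y z x by rewrite distinct_colorsAC distinct_colorsCA.
have zyx : distinct_colors z y x by rewrite distinct_colorsCA.
have xzy : distinct_colors x z y by rewrite distinct_colorsAC.
have : [/\ l2 = 1, l3 = 1, l4 = 1, 1 < l6 & 1 < l7]%N.
  have := predecessor_clash (i := 0) (j := 2) R2 isT isT erefl yzx.
  have := predecessor_clash (i := 2) (j := 4) R2 isT isT erefl zyx.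
  have := predecessor_clash (i := 1) (j := 5) R2 isT isT erefl xzy.
  have := successor_clash (i := 1) (j := 3) R2 isT isT erefl yzx.
  have := successor_clash (i := 1) (j := 6) R2 isT isT erefl yzx.
  have := successor_clash (i := 2) (j := 5) R2 isT isT erefl xyz.
  have := runs_gt0 (m := 1) R2 isT; have := runs_gt0 (m := 2) R2 isT.
  have := runs_gt0 (m := 3) R2 isT; have := runs_gt0 (m := 5) R2 isT.
  have := runs_gt0 (m := 6) R2 isT.
  by rewrite /=; split; lia.
case=> e2 e3 e4 l6_gt1 l7_gt1; have := runs_gt0 (m := 0) R isT => /= l1_gt0.
pose g i := s + d *+ i; pose r := (l1 + 3 + l5)%N.
have := runs_at (m := 0) R isT; have := runs_at (m := 1) R isT.
have := runs_at (m := 2) R isT; have := runs_at (m := 3) R isT.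
have := runs_at (m := 5) R isT; have := runs_at (m := 6) R isT.
rewrite /total /= => r6 r5 r3 r2 r1 r0.
(* Two pairs with the same index sum: the end of the long [y]-run against the change from [x] to
   [z], and the start of the long [z]-run against the change from [x] to [y]. The same element gets
   both colors. *)
have gy : f ((g (r + l6 - 2)%N + g (l1 + 2)%N) / k) = y.
  apply: (@sum_double_color _ (g (r + l6 - 1)%N) (g (l1 + 1)%N) _ x z y xzy).
  - by apply: r5; arith.
  - by apply: r5; arith.
  - by apply: r2; arith.
  - by apply: r3; arith.
  - by apply: sum_along; arith.
have gz : f ((g (r + l6)%N + g l1) / k) = z.
  apply: (@sum_double_color _ (g (r + l6 + 1)%N) (g (l1 - 1)%N) _ x y z xyz).
  - by apply: r6; arith.
  - by apply: r6; arith.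
  - by apply: r0; arith.
  - by apply: r1; arith.
  - by apply: sum_along; arith.
have eg : g (r + l6)%N + g l1 = g (r + l6 - 2)%N + g (l1 + 2)%N.
  by apply: sum_along; arith.
have [[_ _ yz] _] := distinct_colorsE xyz.
by move: yz; rewrite -{1}gy -{1}gz eg eqxx.
Qed.

Lemma progression_ends c d s : d != 0 ->
  (forall t, (t < #|color_class c|)%N -> f (s + d *+ t) = c) ->
  (ends c d <= 1)%N.
Proof.
move=> d0; set n := #|color_class c| => H.
have nF : (n <= #|F|)%N by apply: max_card.
pose g (i : 'I_n) := s + d *+ i.
have g_inj : injective g.
  move=> i j /addrI /(mulrn_inj F_prime d0); rewrite !(leq_trans (ltn_ord _) nF).
  by move/(_ isT isT)/val_inj.
have gC : g @: setT = color_class c.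
  apply/eqP; rewrite eqEcard card_imset // cardsT card_ord leqnn andbT.
  by apply/subsetP=> _ /imsetP[i _ ->]; rewrite inE H.
rewrite /ends /exits -(cards1 (s + d *+ n.-1)); apply: subset_leq_card.
apply/subsetP=> x; rewrite inE -gC => /andP[/imsetP[i _ ->]].
rewrite gC !inE /g -addrA -mulrSr.
have [lt|ge] := ltnP i.+1 n; first by rewrite H // eqxx.
by have -> : n.-1 = i by have := ltn_ord i; lia.
Qed.

(** The clashes leave single points around the seam, where the colors read y, x, y, x: three
    consecutive changes between [x] and [y]. Together with the [l6 - 1] neighbouring pairs of the
    long [z]-run they yield [l6 + 1] consecutive terms of difference d / k in class [z], which has
    exactly [l6 + 1] elements. *)
Lemma xyxzxzy_progression d (x y z : nat) s l1 l2 l3 l4 l5 l6 l7 :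
    let w := [:: (l1, x); (l2, y); (l3, x); (l4, z); (l5, x); (l6, z); (l7, y)] in
    d != 0 -> distinct_colors x y z -> (2 < l2 + l7)%N -> (2 < l4 + l6)%N ->
    runs f d s w -> total w = #|F| -> (ends z (d / k) <= 1)%N.
Proof.
move=> w; rewrite {}/w => d0 xyz b3 c3 R e; have R2 := runs_double R e.
have yzx : distinct_colors y z x by rewrite distinct_colorsAC distinct_colorsCA.
have zyx : distinct_colors z y x by rewrite distinct_colorsCA.
have xzy : distinct_colors x z y by rewrite distinct_colorsAC.
have yxz : distinct_colors y x z by rewrite distinct_colorsCA.
have [l1E l2E l4E l5E [l6_gt1 l7_gt1]] :
    [/\ l1 = 1, l2 = 1, l4 = 1, l5 = 1 & 1 < l6 /\ 1 < l7]%N.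
  have := predecessor_clash (i := 0) (j := 2) R2 isT isT erefl yzx.
  have := predecessor_clash (i := 0) (j := 4) R2 isT isT erefl yzx.
  have := predecessor_clash (i := 3) (j := 5) R2 isT isT erefl xyz.
  have := successor_clash (i := 1) (j := 3) R2 isT isT erefl yzx.
  have := successor_clash (i := 3) (j := 6) R2 isT isT erefl zyx.
  have := successor_clash (i := 0) (j := 5) R2 isT isT erefl xzy.
  have := runs_gt0 (m := 0) R2 isT; have := runs_gt0 (m := 1) R2 isT.
  have := runs_gt0 (m := 3) R2 isT; have := runs_gt0 (m := 4) R2 isT.
  have := runs_gt0 (m := 5) R2 isT; have := runs_gt0 (m := 6) R2 isT.
  by rewrite /=; clear -b3 c3; split; lia.
have := runs_gt0 (m := 2) R isT => /= l3_gt0.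
have cz : #|color_class z| = l6.+1.
  have [[_ xz yz] _] := distinct_colorsE xyz.
  rewrite (runs_card _ d0 R e) /= !(eqxx, negPf xz, negPf yz) /=.
  by clear -l4E; arith.
have r5 := runs_at (m := 5) R2 isT; have r6 := runs_at (m := 6) R2 isT.
have r7 := runs_at (m := 7) R2 isT; have r8 := runs_at (m := 8) R2 isT.
have r9 := runs_at (m := 9) R2 isT.
have {R R2} e : #|F| = (l3 + l6 + l7 + 4)%N.
  by rewrite -e /total /=; clear -l1E l2E l4E l5E; arith.
rewrite /total /= in r5 r6 r7 r8 r9.
clear b3 c3; subst l1 l2 l4 l5; pose g i := s + d *+ i.
have ez i u : (l3 + 4 <= i)%N -> (i.+1 < l3 + 4 + l6)%N ->
    (#|F| <= u.+1)%N -> (u < #|F| + 2)%N -> f ((g i + g u.+1) / k) = z.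
  move=> i1 i2 u1 u2.
  have fi : f (g i) = z by apply: r5; arith.
  have fi' : f (g i.+1) = z by apply: r5; arith.
  have eg : g i + g u.+1 = g i.+1 + g u by apply: sum_along; arith.
  have [uE|[uE|uE]] : u = #|F|.-1 \/ u = #|F| \/ u = #|F|.+1 by arith.
  - apply: (sum_double_color yxz fi fi' _ _ eg).
      by apply: r6; arith.
    by apply: r7; arith.
  - apply: (sum_double_color xyz fi fi' _ _ eg).
      by apply: r7; arith.
    by apply: r8; arith.
  - apply: (sum_double_color yxz fi fi' _ _ eg).
      by apply: r8; arith.
    by apply: r9; arith.
apply: (@progression_ends z (d / k) ((g (l3 + 4)%N + g #|F|) / k)).
  by rewrite mulf_neq0 // invr_eq0.
rewrite cz => t tl.
have et i j : (i + j = l3 + 4 + (#|F| + t))%N ->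
    (g (l3 + 4)%N + g #|F|) / k + d / k *+ t = (g i + g j) / k.
  move=> ij; rewrite -mulrnAl -mulrDl -addrA; congr (_ / k).
  rewrite /g -[s + d *+ #|F| + _]addrA -mulrnDr; exact: sum_along.
have [t0|t_gt0] := leqP t (l6 - 2).
  rewrite (et (l3 + 4 + t)%N #|F|.-1.+1); last by arith.
  by apply: ez; arith.
rewrite (et (l3 + 2 + l6)%N (#|F| + (t - l6.-2)).-1.+1); last by arith.
by apply: ez; arith.
Qed.

(** Division by [k] maps the sumset injectively into the union of the two classes. *)
Lemma card_sumset_colors (a b c : nat) : distinct_colors a b c ->
  (#|sumset (color_class a) (color_class b)| <=
   #|color_class a| + #|color_class b|)%N.
Proof.
move=> abc; have [[ab _ _] _] := distinct_colorsE abc.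
apply: leq_trans (leq_card_setU _ _).
have inj : injective (fun x => x / k) by apply: mulIf; rewrite invr_eq0.
rewrite -(card_imset (mem (sumset _ _)) inj); apply: subset_leq_card.
apply/subsetP=> _ /imsetP[_ /imset2P[x y xa yb ->] ->].
move: xa yb; rewrite !inE => /eqP fx /eqP fy; exact: sum_color fx fy ab.
Qed.

Lemma intervals_card (S : {set F}) d s t rs : d != 0 ->
  intervals (fun i => s + d *+ i \in S) t rs (t + #|F|) -> (sumn (unzip2 rs) <= #|S|)%N.
Proof.
move=> d0.
have H u : intervals (fun i => s + d *+ i \in S) t rs u -> (t <= u)%N /\
   (sumn (unzip2 rs) <= \sum_(t <= i < u) ((s + d *+ i)%R \in S))%N.
  elim: rs t => [|[v l] rs IH] t /=; first by move=> ->.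
  move=> [tv Sv /IH[vlu le]]; have vu := leq_trans (leq_addr l v) vlu.
  split; first exact: leq_trans tv vu.
  rewrite (big_cat_nat tv vu) /= (big_cat_nat (leq_addr l v) vlu) /=.
  apply: leq_trans (leq_addl _ _); apply: leq_add le.
  rewrite (eq_big_nat _ _ (F2 := fun=> 1%N)).
    by rewrite sum_nat_const_nat addKn muln1.
  by move=> i /andP[vi il]; rewrite Sv.
case/H=> _ /leq_trans; apply; rewrite -{1}[t]add0n big_addn addKn big_mkord.
have inj : injective (fun i : 'I_#|F| => s + d *+ (i + t)).
  move=> i j; rewrite !mulrnDr => /addrI /addIr.
  by move/(mulrn_inj F_prime d0 (ltn_ord i) (ltn_ord j))/val_inj.
have bij : bijective (fun i : 'I_#|F| => s + d *+ (i + t)).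
  by apply: inj_card_bij inj _; rewrite card_ord.
rewrite -sum1_card [X in (_ <= X)%N]big_mkcond /=.
rewrite [X in (_ <= X)%N](reindex (fun i : 'I_#|F| => s + d *+ (i + t))) /=.
  by apply: leq_sum => i _; case: (_ \in S).
exact: onW_bij.
Qed.

Lemma sumset_interval d s a b (u l v m i : nat) :
    (forall j, (u <= j)%N -> (j < u + l)%N -> f (s + d *+ j) = a) ->
    (forall j, (v <= j)%N -> (j < v + m)%N -> f (s + d *+ j) = b) ->
    (0 < l)%N -> (0 < m)%N -> (u + v <= i)%N -> (i < u + v + l + m - 1)%N ->
  s + s + d *+ i \in sumset (color_class a) (color_class b).
Proof.
move=> Hu Hv l0 m0 i1 i2.
have [j [j1 j2 j3 j4]] : exists j, [/\ (u <= j)%N, (j < u + l)%N,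
    (v <= i - j)%N & (j <= i)%N /\ (i - j < v + m)%N].
  case: (leqP i (u + l - 1 + v)) => h.
    by exists (i - v)%N; split; arith.
  by exists (u + l - 1)%N; split; arith.
have -> : s + s + d *+ i = (s + d *+ j) + (s + d *+ (i - j)).
  by rewrite addrACA -mulrnDr subnKC //; case: j4.
by apply: mem_sumset; rewrite inE ?(Hu j) ?(Hv (i - j)%N) //; case: j4.
Qed.

Lemma xyzxyz_sums d (x y z : nat) s a1 b1 c1 a2 b2 c2 :
    let w := [:: (a1, x); (b1, y); (c1, z); (a2, x); (b2, y); (c2, z)] in
    d != 0 -> distinct_colors x y z -> runs f d s w -> total w = #|F| ->
  two_block_sums (fun i => s + s + d *+ i \in sumset (color_class x) (color_class y))
    a1 b1 c1 a2 b2 c2.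
Proof.
move=> w; rewrite {}/w => d0 xyz R e.
have [[xy xz yz] [[yx zx zy] _]] := distinct_colorsE xyz.
have := runs_gt0 (m := 0) R isT; have := runs_gt0 (m := 1) R isT.
have := runs_gt0 (m := 2) R isT; have := runs_gt0 (m := 3) R isT.
have := runs_gt0 (m := 4) R isT; have := runs_gt0 (m := 5) R isT.
have r0 := runs_at (m := 0) R isT; have r1 := runs_at (m := 1) R isT.
have r3 := runs_at (m := 3) R isT; have r4 := runs_at (m := 4) R isT.
rewrite /total /= in r0 r1 r3 r4 * => c2p b2p a2p c1p b1p a1p.
have eF : #|F| = (a1 + b1 + c1 + a2 + b2 + c2)%N.
  by rewrite -e /total /=; clear; lia.
split=> //.
- by move=> i i1 i2; apply: (sumset_interval r0 r1); arith.
- by move=> i i1 i2; apply: (sumset_interval r0 r4); arith.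
- by move=> i i1 i2; apply: (sumset_interval r3 r1); arith.
- by move=> i i1 i2; apply: (sumset_interval r3 r4); arith.
- by move=> i; rewrite -eF mulrnDr mulrn_card addr0.
move=> t rs; rewrite -eF => /(intervals_card d0)/leq_trans; apply.
apply: leq_trans (card_sumset_colors xyz) _.
rewrite !(runs_card _ d0 R e) /= !(eqxx, negPf xy, negPf yx, negPf zx, negPf zy) /=.
by clear; lia.
Qed.

(** Applied to the three pairs of successive classes, [two_block_half] puts the two [x]-runs half a
    turn apart: 2 (a1 + b1 + c1) is q + 1 or q - 1, as q is odd, and the lengths [a1], [a2] differ
    by at most one. For h = d / 2 the first run then occupies even multiples of h and the second one
    odd multiples, and they interleave to one progression. *)
Lemma xyzxyz_progression d (x y z : nat) s a1 b1 c1 a2 b2 c2 :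
    let w := [:: (a1, x); (b1, y); (c1, z); (a2, x); (b2, y); (c2, z)] in
    odd #|F| -> d != 0 -> distinct_colors x y z ->
    (2 < a1 + a2)%N -> (2 < b1 + b2)%N -> (2 < c1 + c2)%N ->
    runs f d s w -> total w = #|F| ->
  exists2 d', d' != 0 & (ends x d' <= 1)%N.
Proof.
move=> w; rewrite {}/w => q_odd d0 xyz a3 b3 c3 R e.
have yzx : distinct_colors y z x by rewrite distinct_colorsAC distinct_colorsCA.
have zxy : distinct_colors z x y by rewrite distinct_colorsCA distinct_colorsAC.
have eF : #|F| = (a1 + b1 + c1 + a2 + b2 + c2)%N.
  by rewrite -e /total /=; clear; lia.
have [s1 [R1 e1]] := runs_rot 1 R e; have [s2 [R2 e2]] := runs_rot 2 R e.
have [s3 [R3 e3]] := runs_rot 3 R e; have [s4 [R4 e4]] := runs_rot 4 R e.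
have [s5 [R5 e5]] := runs_rot 5 R e.
have T0 := xyzxyz_sums d0 xyz R e; have T1 := xyzxyz_sums d0 yzx R1 e1.
have T2 := xyzxyz_sums d0 zxy R2 e2; have T3 := xyzxyz_sums d0 xyz R3 e3.
have T4 := xyzxyz_sums d0 yzx R4 e4; have T5 := xyzxyz_sums d0 zxy R5 e5.
have [B1 B2] := two_block_half T0 T3 a3 b3 c3.
have [C1 C2] : (2 * (c1 + a2 + b2) <= b1 + c1 + a2 + b2 + c2 + a1 + 2)%N /\
    (b1 + c1 + a2 + b2 + c2 + a1 <= 2 * (c1 + a2 + b2) + 2)%N.
  by apply: (two_block_half T1 T4 b3 c3); rewrite addnC.
have [A1 A2] : (2 * (a2 + b2 + c2) <= c1 + a2 + b2 + c2 + a1 + b1 + 2)%N /\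
    (c1 + a2 + b2 + c2 + a1 + b1 <= 2 * (a2 + b2 + c2) + 2)%N.
  by apply: (two_block_half T2 T5 c3); rewrite addnC.
have cx : #|color_class x| = (a1 + a2)%N.
  have [[_ _ _] [[yx zx _] _]] := distinct_colorsE xyz.
  rewrite (runs_card _ d0 R e) /= !(eqxx, negPf yx, negPf zx) /=.
  by rewrite addn0.
have r0 := runs_at (m := 0) R isT; have r3 := runs_at (m := 3) R isT.
rewrite /total /= in r0 r3.
have two0 : 2%:R != 0 :> F.
  rewrite (mulrn_eq0_card F_prime) ?oner_eq0 //.
  apply/negP=> h; have {}h : (#|F| <= 2)%N := dvdn_leq (ltn0Sn 1) h.
  by arith.
pose h := d / 2%:R; have hd : h *+ 2 = d by rewrite -mulr_natr divfK.
have h0 : h != 0 by rewrite mulf_neq0 // invr_eq0.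
have hF : h *+ #|F| = 0 by apply: mulrn_card.
exists h => //.
have g0 i : (i < a1)%N -> f (s + h *+ (2 * i)) = x.
  by move=> i1; rewrite mulrnA hd; apply: r0; arith.
have g3 i : (i < a2)%N -> f (s + h *+ (2 * (a1 + b1 + c1) + 2 * i)) = x.
  by move=> i1; rewrite -mulnDr mulrnA hd; apply: r3; arith.
have := odd_double_half #|F|; rewrite q_odd => qE.
have [eE|eE] : (2 * (a1 + b1 + c1) = #|F| + 1 \/ 2 * (a1 + b1 + c1) + 1 = #|F|)%N.
- by rewrite eF in qE *; arith.
- have {}g3 i : (i < a2)%N -> f (s + h *+ (2 * i + 1)) = x.
    by move=> /g3; rewrite eE -addnA mulrnDr hF add0r addnC.
  apply: (@progression_ends x h s h0) => t; rewrite cx => tl.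
  have [u [tE|tE]] : exists u, t = (2 * u)%N \/ t = (2 * u + 1)%N.
    by exists t./2; arith.
    by rewrite tE; apply: g0; rewrite eF in qE eE; arith.
  by rewrite tE; apply: g3; rewrite eF in qE eE; arith.
apply: (@progression_ends x h (s - h) h0) => t; rewrite cx => tl.
have [u [tE|tE]] : exists u, t = (2 * u)%N \/ t = (2 * u + 1)%N.
  by exists t./2; arith.
  have -> : s - h + h *+ t = s + h *+ (2 * (a1 + b1 + c1) + 2 * u).
    rewrite -tE -addrA; congr (s + _); rewrite mulrnDr; congr (_ + _).
    by apply: (addIr h); rewrite -mulrSr -addn1 eE hF addNr.
  by apply: g3; rewrite eF in qE eE; arith.
have -> : s - h + h *+ t = s + h *+ (2 * u).
  by rewrite tE addn1 mulrS addrA subrK.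
by apply: g0; rewrite eF in qE eE; arith.
Qed.

Lemma ends_222 d : odd #|F| -> d != 0 ->
    (forall c, (c < 3)%N -> (2 < #|color_class c|)%N) ->
    (forall c, (c < 3)%N -> ends c d = 2%N) ->
  exists d' c, [/\ d' != 0, (c < 3)%N & (ends c d' <= 1)%N].
Proof.
move=> q_odd d0 big e2.
have [|w [w3 cw countw rotw]] := @color_word d 0 d0; first by rewrite e2.
have [||| r [x [y [z [xyz er]]]]] := word_222 w3 cw; rewrite ?countw ?e2 //.
have [_ [_ [x3 y3 z3]]] := distinct_colorsE xyz.
have [[xy xz yz] [[yx zx zy] _]] := distinct_colorsE xyz.
have [s [rw [R e uw]]] := rotw r.
case: er => er; rewrite {}er in uw; move: rw R e uw =>
  [|[l1 ?] [|[l2 ?] [|[l3 ?] [|[l4 ?] [|[l5 ?] [|[l6 ?] [|? ?]]]]]]] // R e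
  /= [? ? ? ? ? ?]; subst.
- have := big _ x3; have := big _ y3; have := big _ z3.
  rewrite !(runs_card _ d0 R e) /=.
  rewrite !(eqxx, negPf xy, negPf xz, negPf yx, negPf yz, negPf zx, negPf zy) /=.
  rewrite !addn0 => c3 b3 a3.
  have [d' ? ?] := xyzxyz_progression q_odd d0 xyz a3 b3 c3 R e.
  by exists d', x.
- have := big _ x3; have := big _ y3; have := big _ z3.
  rewrite !(runs_card _ d0 R e) /=.
  rewrite !(eqxx, negPf xy, negPf xz, negPf yx, negPf yz, negPf zx, negPf zy) /=.
  rewrite !addn0 => c3 b3 a3.
  by case: (not_xyxzyz xyz a3 b3 c3 R e).
Qed.

Lemma ends_322 d (a b c : nat) : d != 0 -> distinct_colors a b c ->
    (forall c, (c < 3)%N -> (2 < #|color_class c|)%N) ->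
    ends a d = 3%N -> ends b d = 2%N -> ends c d = 2%N ->
  exists d' c, [/\ d' != 0, (c < 3)%N & (ends c d' <= 1)%N].
Proof.
move=> d0 abc big ea eb ec.
have [|w [w3 cw countw rotw]] := @color_word d a d0; first by rewrite ea.
have [||| r [x [y [z [xyz er]]]]] := word_322 abc w3 cw; rewrite ?countw //.
have [_ [_ [x3 y3 z3]]] := distinct_colorsE xyz.
have [[xy xz yz] [[yx zx zy] _]] := distinct_colorsE xyz.
have [s [rw [R e uw]]] := rotw r.
case: er => er; rewrite {}er in uw; move: rw R e uw =>
  [|[l1 ?] [|[l2 ?] [|[l3 ?] [|[l4 ?] [|[l5 ?] [|[l6 ?] [|[l7 ?] [|? ?]]]]]]]] // R e
  /= [? ? ? ? ? ? ?]; subst.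
- have := big _ y3; have := big _ z3.
  rewrite !(runs_card _ d0 R e) /=.
  rewrite !(eqxx, negPf xy, negPf xz, negPf yz, negPf zy) /= !addn0 => c3 b3.
  by case: (not_xyxzxyz xyz b3 c3 R e).
- have := big _ y3; have := big _ z3.
  rewrite !(runs_card _ d0 R e) /=.
  rewrite !(eqxx, negPf xy, negPf xz, negPf yz, negPf zy) /= !addn0 => c3 b3.
  have := xyxzxzy_progression d0 xyz b3 c3 R e.
  by exists (d / k), z; rewrite mulf_neq0 // invr_eq0.
Qed.

(** * From a small sumset to progressions *)

Lemma card_classes (a b c : nat) : distinct_colors a b c ->
  (#|color_class a| + #|color_class b| + #|color_class c| = #|F|)%N.
Proof.
move=> abc; have [[ab ac bc] _] := distinct_colorsE abc.
have <- : #|[set: F]| = #|F| by apply: cardsT.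
have -> : [set: F] = color_class a :|: color_class b :|: color_class c.
  by apply/setP=> x; rewrite !inE -orbA (three_colors x abc).
have d1 : color_class a :&: color_class b = set0.
  apply/setP=> x; rewrite !inE; apply/negP=> /andP[/eqP-> ].
  by rewrite (negPf ab).
have d2 : (color_class a :|: color_class b) :&: color_class c = set0.
  apply/setP=> x; rewrite !inE; apply/negP=> /andP[/orP[] /eqP->].
    by rewrite (negPf ac).
  by rewrite (negPf bc).
by rewrite cardsU d2 cards0 subn0 cardsU d1 cards0 subn0.
Qed.

Lemma progression_all d (c : nat) : d != 0 -> (c < 3)%N ->
    (forall e, (e < 3)%N -> (1 < #|color_class e|)%N) ->
  (ends c d <= 1)%N -> forall e, (e < 3)%N -> ends e d = 1%N.
Proof.
move=> d0 c3 big ec e e3.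
have [a [b abc]] : exists a b, distinct_colors a b c.
  by move: c c3 {ec} => [|[|[|?]]] // _; [exists 1%N, 2%N|exists 0%N, 2%N|exists 0%N, 1%N].
have [[ab ac bc] [_ [a3 _ _]]] := distinct_colorsE abc.
have ec1 : ends c d = 1%N.
  apply/eqP; rewrite eqn_leq ec /=; apply: ends_gt0 => //; first exact/ltnW/big.
  have /ltnW/card_gt0P[u] := big a a3; rewrite inE => /eqP fu.
  by exists u; rewrite fu.
have [ea eb] := all_progressions d0 abc big ec1.
have : [|| e == a, e == b | e == c].
  by move/color_triplesE: abc; move: e e3 => [|[|[|?]]] // _; rewrite !inE;
    do ![case/orP] => /eqP[-> -> ->].
by case/or3P=> /eqP->.
Qed.

Lemma classes_are_progressions :
    (forall c, (c < 3)%N -> (1 < #|color_class c|)%N) ->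
  exists2 d, d != 0 & forall c, (c < 3)%N -> ends c d = 1%N.
Proof.
move=> big.
suff [d [c [d0 c3 ec]]] : exists d c, [/\ d != 0, (c < 3)%N & (ends c d <= 1)%N].
  by exists d => //; apply: progression_all ec.
have card3 := @card_classes 0 1 2 isT.
have [[c /andP[c3 /cards2P[x [y [xy cE]]]]]|big3] :
    {c | (c < 3)%N && (#|color_class c| == 2%N)} +
    (forall c, (c < 3)%N -> (2 < #|color_class c|)%N).
  case: (pickP [pred c : 'I_3 | #|color_class c| == 2%N]) => [c cE|none].
    by left; exists (val c); apply/andP; split; [apply: ltn_ord|].
  right=> c c3; have := big c c3; have /= := none (Ordinal c3).
  by rewrite leq_eqVlt eq_sym => ->.
- exists (y - x), c; split=> //; first by rewrite subr_eq0 eq_sym.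
  have := card_inner c (y - x).
  have : (0 < #|inner c (y - x)%R|)%N.
    apply/card_gt0P; exists x; rewrite inE addrC subrK.
    have : x \in color_class c by rewrite cE !inE eqxx.
    have : y \in color_class c by rewrite cE !inE eqxx orbT.
    by rewrite !inE => -> ->.
  by rewrite cE cards2 xy; lia.
(* Three classes of at least three elements make 9, and the next prime is 11; with a smallest class
   of at most a third of the field, this provides the 7 in [two_strings]. *)
have q11 : (10 < #|F|)%N.
  have q9 : (8 < #|F|)%N.
    have := big3 0%N isT; have := big3 1%N isT; have := big3 2%N isT.
    by rewrite -card3; lia.
  by move: F_prime q9; move: #|F| => [|[|[|[|[|[|[|[|[|[|[|?]]]]]]]]]]].
have q_odd : odd #|F|.
  by case: (even_prime F_prime) => // e2; move: q11; rewrite e2.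
have [c [c3 small]] : exists c, (c < 3)%N /\ (3 * #|color_class c| <= #|F|)%N.
  move: card3; case: (leqP #|color_class 0| #|color_class 1|) => h1;
  case: (leqP #|color_class 0| #|color_class 2|) => h2;
  case: (leqP #|color_class 1| #|color_class 2|) => h3 e;
  first [by exists 0%N; split=> //; rewrite -e; arith
        |by exists 1%N; split=> //; rewrite -e; arith
        |by exists 2%N; split=> //; rewrite -e; arith].
have [a [b abc]] : exists a b, distinct_colors a b c.
  by move: c c3 {small} => [|[|[|?]]] // _; [exists 1%N, 2%N|exists 0%N, 2%N|exists 0%N, 1%N].
have [[ab ac bc] [_ [a3 b3 _]]] := distinct_colorsE abc.
have acb : distinct_colors a c b by rewrite distinct_colorsAC.
have bac : distinct_colors b a c by rewrite distinct_colorsCA.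
have cab : distinct_colors c a b by rewrite distinct_colorsCA.
have cards := card_classes abc; have sums := card_sumset_colors acb.
have := big3 a a3; have := big3 b b3; have := big3 c c3 => gc gb ga.
have h7 : (#|color_class c| + 7 <= #|F|)%N by arith.
have h2 : (#|color_class a| + #|color_class c| + 2 <= #|F|)%N.
  by rewrite -cards; arith.
have [|||||d d0 ec] := @two_strings F F_prime (color_class c) (color_class a).
- exact: ltnW.
- exact: h7.
- exact: ltnW.
- by apply: leq_trans h2; rewrite addn2 !ltnS.
- exact: sums.
rewrite -/(ends c d) in ec.
have [ec1|ec2] : (ends c d <= 1)%N \/ ends c d = 2%N by arith.
  by exists d, c.
have [ea1|ea1] := leqP (ends a d) 1; first by exists d, a.
have [eb1|eb1] := leqP (ends b d) 1; first by exists d, b.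
have inn : (0 < #|inner c d|)%N by have := card_inner c d; arith.
have := boundary_le abc inn; have := ends_boundary d abc.
have := ends_boundary d bac; have := ends_boundary d cab.
rewrite (boundaryC b a) (boundaryC c a) (boundaryC c b) ec2 => i1 i2 i3 i4.
(* Here [ends a d + ends b d = #|boundary a b d| + 2], at most 5, while both terms are at least
   2. *)
have [[ea eb]|[[ea eb]|[ea eb]]] : (ends a d = 2 /\ ends b d = 2) \/
    (ends a d = 3 /\ ends b d = 2) \/ (ends a d = 2 /\ ends b d = 3) by arith.
- apply: (ends_222 q_odd d0 big3) => e e3.
  have : [|| e == a, e == b | e == c].
    by move/color_triplesE: abc; move: e e3 => [|[|[|?]]] // _; rewrite !inE;
      do ![case/orP] => /eqP[-> -> ->].
  by case/or3P=> /eqP->.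
- exact: ends_322 d0 abc big3 ea eb ec2.
- exact: ends_322 d0 bac big3 eb ea ec2.
Qed.

End Coloring.

(** * Progressions under a change of difference *)

Section Arcs.

Variable V : finZmodType.
Implicit Types (S : {set V}) (d s : V).

Lemma exits_disjointU (A B : {set V}) d : [disjoint A & B] ->
  (exits d A + exits d B = exits d (A :|: B) +
    #|[set x in A | (x + d)%R \in B]| + #|[set x in B | (x + d)%R \in A]|)%N.
Proof.
move=> /pred0P disAB; have dis x : x \in A -> (x \in B) = false.
  by move=> xA; apply/negbTE; apply: contraFN (disAB x) => xB; rewrite /= xA.
rewrite /exits.
have eA : #|[set x in A | (x + d)%R \notin A]| =
   (#|[set x in A | (x + d)%R \notin A :|: B]| + #|[set x in A | (x + d)%R \in B]|)%N.
  rewrite -cardsUI (_ : _ :&: _ = set0) ?cards0 ?addn0.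
    apply: eq_card => x; rewrite !inE; have := dis (x + d).
    by do 3!case: (_ \in _) => //=; move=> /(_ isT).
  by apply/setP=> x; rewrite !inE; do 3!case: (_ \in _).
have eB : #|[set x in B | (x + d)%R \notin B]| =
   (#|[set x in B | (x + d)%R \notin A :|: B]| + #|[set x in B | (x + d)%R \in A]|)%N.
  rewrite -cardsUI (_ : _ :&: _ = set0) ?cards0 ?addn0.
    apply: eq_card => x; rewrite !inE; have := dis (x + d).
    by do 3!case: (_ \in _) => //=; move=> /(_ isT).
  by apply/setP=> x; rewrite !inE; do 3!case: (_ \in _).
have eU : #|[set x in A :|: B | (x + d)%R \notin A :|: B]| =
   (#|[set x in A | (x + d)%R \notin A :|: B]| +
    #|[set x in B | (x + d)%R \notin A :|: B]|)%N.
  rewrite -cardsUI (_ : _ :&: _ = set0) ?cards0 ?addn0.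
    by apply: eq_card => x; rewrite !inE andb_orl.
  apply/setP=> x; rewrite !inE; apply/negP=> /andP[/andP[xA _] /andP[xB _]].
  by rewrite dis in xB.
by rewrite eA eB eU; lia.
Qed.

Hypothesis V_prime : prime #|V|.

(** The only exit [e] is the last term. On the walk from [e + d] around to [e], membership in [S],
    once gained, cannot be lost before [e]. *)
Lemma arcP S d : d != 0 -> exits d S = 1%N ->
  exists s, forall t, (t < #|V|)%N -> (s + d *+ t \in S) = (t < #|S|)%N.
Proof.
move=> d0 /eqP/cards1P[e eE].
have exit_e x : x \in S -> x + d \notin S -> x = e.
  by move=> xS xdS; apply/set1P; rewrite -eE inE xS.
have : e \in [set x in S | x + d \notin S] by rewrite eE inE.
rewrite inE => /andP[eS edS].
pose g i := e + d + d *+ i; have g_last : g #|V|.-1 = e.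
  by rewrite /g -addrA -mulrS prednK ?prime_gt0 // mulrn_card // addr0.
have ex_in : exists i, g i \in S by exists #|V|.-1; rewrite g_last.
case: (ex_minnP ex_in) => m gm min_m.
have ltmV : (m < #|V|)%N.
  by rewrite -(prednK (prime_gt0 V_prime)) ltnS; apply: min_m; rewrite g_last.
have g_in i : (m <= i)%N -> (i < #|V|)%N -> g i \in S.
  elim: i => [|i IH]; first by rewrite leqn0 => /eqP <-.
  rewrite leq_eqVlt => /orP[/eqP <- //|]; rewrite ltnS => mi iV.
  have gi := IH mi (ltnW iV); apply: contraT => giN.
  have gS : g i.+1 = g i + d by rewrite /g mulrSr addrA.
  have /eqP : g i = e by apply: exit_e; rewrite -?gS.
  rewrite -g_last /g => /eqP /addrI /(mulrn_inj V_prime d0 (ltnW iV)).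
  by have := ltn_predL #|V|; lia.
have g_out i : (i < m)%N -> g i \notin S.
  by move=> im; apply: contraL im => /min_m; rewrite -leqNgt.
have memS t : (t < #|V|)%N -> (g m + d *+ t \in S) = (t < #|V| - m)%N.
  have -> : g m + d *+ t = g (m + t)%N by rewrite /g mulrnDr addrA.
  move=> tV; case: (ltnP t (#|V| - m)) => tm.
    by apply: g_in; lia.
  have -> : g (m + t)%N = g (m + t - #|V|)%N.
    have mtV : (#|V| <= m + t)%N by lia.
    by rewrite /g -{1}(subnK mtV) mulrnDr mulrn_card addr0.
  by apply/negbTE/g_out; lia.
exists (g m) => t tV; rewrite memS //; congr (_ < _)%N.
pose h (i : 'I_(#|V| - m)) := g m + d *+ i.
have ltV (i : 'I_(#|V| - m)) : (i < #|V|)%N by apply: leq_trans (ltn_ord i) _; lia.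
have h_inj : injective h.
  by move=> i j /addrI /(mulrn_inj V_prime d0 (ltV i) (ltV j))/val_inj.
rewrite -[LHS]card_ord -cardsT -(card_imset _ h_inj).
apply: eq_card => x; apply/imsetP/idP => [[i _ ->]|xS].
  by rewrite memS ?ltV ?ltn_ord.
have [i iV xE] := addrn_surj V_prime (g m) x d0.
have im : (i < #|V| - m)%N by rewrite -memS // -xE.
by exists (Ordinal im).
Qed.

Lemma arc_exits_multiple S d m j : d != 0 -> exits d S = 1%N ->
    (j <= m)%N -> (m + j <= #|V|)%N -> (j <= #|S|)%N -> (#|S| + j <= #|V|)%N ->
  (j <= exits (d *+ m) S)%N.
Proof.
move=> d0 /(arcP d0)[s sS] jm mjV jS SjV; case: j jm mjV jS SjV => // j' jm mjV jS SjV.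
set j := j'.+1 in jm mjV jS SjV *.
(* Indices of [j] points of the progression that step [m] carries into the complement. For
   [m > #|S|] the truncated subtraction gives 0, and the first [j] points serve. *)
pose t (i : 'I_j) := (#|S| - m + i)%N.
have bt i : (t i < #|S|)%N /\ (#|S| <= t i + m)%N /\ (t i + m < #|V|)%N.
  by rewrite /t; have := ltn_ord i; lia.
pose h (i : 'I_j) := s + d *+ t i.
have h_inj : injective h.
  have lt i : (t i < #|V|)%N by have := bt i; lia.
  by move=> i i' /addrI /(mulrn_inj V_prime d0 (lt i) (lt i')) /addnI /val_inj.
rewrite -[X in (X <= _)%N]card_ord -cardsT -(card_imset _ h_inj).
apply/subset_leq_card/subsetP=> _ /imsetP[i _ ->]; have [t1 [t2 t3]] := bt i.
rewrite inE /h -addrA -mulrnDr !sS //; last by lia.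
by rewrite t1 -leqNgt.
Qed.

End Arcs.

(** * Progressions and singletons as color classes *)

Section Obstructions.

Variables (F : finFieldType) (k : F) (f : F -> nat).
Hypothesis F_prime : prime #|F|.
Hypothesis k0 : k != 0.
Hypothesis rf : forall x y z, x + y = k * z ->
  [|| f x == f y, f x == f z | f y == f z].

Lemma natr_neq0 n : (0 < n)%N -> (n < #|F|)%N -> n%:R != 0 :> F.
Proof.
move=> n0 nF; rewrite mulrn_eq0_card ?oner_eq0 //.
apply/negP=> /(dvdn_leq n0) h; have {}h : (#|F| <= n)%N := h.
by move: nF; rewrite ltnNge h.
Qed.

(** A step of [m] times [d], with [m] and its complement to |F| both at least 3, would leave [S] at
    three points by [arc_exits_multiple]; so [e] is the residue of an integer between -2 and 2. *)
Lemma small_exits_multiple (S : {set F}) (d e : F) : d != 0 -> exits d S = 1%N ->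
    (2 < #|S|)%N -> (#|S| + 3 <= #|F|)%N -> e != 0 ->
    (exits (e * d)%R S <= 2)%N ->
  [|| e == 1, e == -1, e == 2%:R | e == - 2%:R].
Proof.
move=> d0 ed S3 SF e0 le2.
have [m mF em] := mulrn_surj F_prime (e * d) d0.
have eE : e = m%:R by apply: (mulIf d0); rewrite em mulr_natl.
have : (m < 3)%N || (#|F| < m + 3)%N.
  rewrite ltnNge (ltnNge #|F|) -negb_and; apply/negP=> /andP[m3 mF3].
  have := @arc_exits_multiple F F_prime S d m 3 d0 ed m3 mF3 S3 SF.
  by rewrite -em leqNgt ltnS le2.
have natF : #|F|%:R = 0 :> F by apply: mulrn_card.
case/orP=> hm.
  move: m mF em eE hm => [|[|[|?]]] // _ _ eE _; rewrite eE ?eqxx ?orbT //.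
  by rewrite eE eqxx in e0.
have mE : m%:R = - (#|F| - m)%:R :> F.
  by rewrite natrB ?(ltnW mF) // natF sub0r opprK.
have : (0 < #|F| - m)%N by rewrite subn_gt0.
have : (#|F| - m < 3)%N by rewrite ltn_subLR ?(ltnW mF) // addnC.
rewrite eE mE; move: (#|F| - m)%N => [|[|[|?]]] // _ _; by rewrite eqxx ?orbT.
Qed.

Lemma no_three_progressions (d : F) : k != -1 -> d != 0 ->
    (forall x, (f x < 3)%N) ->
    (forall c, (c < 3)%N -> (1 < #|color_class f c|)%N) ->
    (forall c, (c < 3)%N -> ends f c d = 1%N) -> False.
Proof.
move=> kN1 d0 f3 big ends1.
have card3 := card_classes f3 (isT : distinct_colors 0 1 2).
have q7 : (6 < #|F|)%N.
  have q6 : (5 < #|F|)%N.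
    have := big 0%N isT; have := big 1%N isT; have := big 2%N isT.
    by rewrite -card3; lia.
  by move: F_prime q6; move: #|F| => [|[|[|[|[|[|[|?]]]]]]].
have inn a e : (a < 3)%N -> ends f a e = 1%N -> (0 < #|inner f a e|)%N.
  by move=> a3 ea; have := card_inner f a e; have := big a a3; arith.
have [c [c3 big_c]] : exists c, (c < 3)%N /\ (2 < #|color_class f c|)%N.
  have [h|h] := ltnP 2 #|color_class f 0|; first by exists 0%N.
  have [h'|h'] := ltnP 2 #|color_class f 1|; first by exists 1%N.
  by exists 2%N; split=> //; move: q7; rewrite -card3; arith.
have [a [b abc]] : exists a b, distinct_colors a b c.
  by move: c c3 {big_c} => [|[|[|?]]] // _; [exists 1%N, 2%N|exists 0%N, 2%N|exists 0%N, 1%N].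
have [[ab ac bc] [_ [a3 b3 _]]] := distinct_colorsE abc.
have acb : distinct_colors a c b by rewrite distinct_colorsAC.
have bca : distinct_colors b c a by rewrite distinct_colorsAC distinct_colorsCA.
have cab : distinct_colors c a b by rewrite distinct_colorsCA distinct_colorsAC.
have bac : distinct_colors b a c by rewrite distinct_colorsCA.
have SF : (#|color_class f c| + 3 <= #|F|)%N.
  by have := card_classes f3 abc; have := big a a3; have := big b b3; arith.
have ec := ends1 c c3.
have ec_mul : (ends f c (k * d)%R <= 2)%N.
  have := boundary_le_mul F_prime k0 rf acb (inn _ _ b3 (ends1 b b3)).
  have := boundary_le_mul F_prime k0 rf bca (inn _ _ a3 (ends1 a a3)).
  have := ends_boundary F_prime k0 f3 (k * d) cab.
  by rewrite (boundaryC f a c) (boundaryC f b c) !ends1 //; arith.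
have ec_div : (ends f c (k^-1 * d)%R <= 2)%N.
  have kd : k * (k^-1 * d) = d by rewrite mulrA divff // mul1r.
  have := boundary_le_div (d := k^-1 * d) F_prime k0 rf acb.
  have := boundary_le_div (d := k^-1 * d) F_prime k0 rf bca.
  have := ends_boundary F_prime k0 f3 (k^-1 * d) cab.
  rewrite kd (boundaryC f a c) (boundaryC f b c) !ends1 // => e.
  move=> /(_ (inn _ _ a3 (ends1 a a3))) ha /(_ (inn _ _ b3 (ends1 b b3))) hb.
  by arith.
have kV0 : k^-1 != 0 by rewrite invr_eq0.
have k_small := small_exits_multiple d0 ec big_c SF k0 ec_mul.
have kV_small := small_exits_multiple d0 ec big_c SF kV0 ec_div.
have k1 : k = 1.
  have kkV : k * k^-1 = 1 by rewrite divff.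
  (* If k is 2 or -2, each of the four values of 1 / k would make 1, 3 or 5 vanish in the field,
     whose order is at least 7. *)
  have n1 := @natr_neq0 1 isT (leq_trans (isT : (1 < 7)%N) q7).
  have n3 := @natr_neq0 3 isT (leq_trans (isT : (3 < 7)%N) q7).
  have n5 := @natr_neq0 5 isT (leq_trans (isT : (5 < 7)%N) q7).
  have absurd n (u v : F) : n%:R != 0 :> F -> u = v -> n%:R = u - v \/ n%:R = v - u -> False.
    by move=> n0 -> [] e; rewrite e subrr eqxx in n0.
  case/or4P: k_small kkV => /eqP kE; first by [].
  - by rewrite kE eqxx in kN1.
  - case/or4P: kV_small => /eqP ->; rewrite kE => e; exfalso.
    + by apply: (absurd _ _ _ n1 e); left; ring.
    + by apply: (absurd _ _ _ n3 e); right; ring.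
    + by apply: (absurd _ _ _ n3 e); left; ring.
    + by apply: (absurd _ _ _ n5 e); right; ring.
  - case/or4P: kV_small => /eqP ->; rewrite kE => e; exfalso.
    + by apply: (absurd _ _ _ n3 e); right; ring.
    + by apply: (absurd _ _ _ n1 e); left; ring.
    + by apply: (absurd _ _ _ n5 e); right; ring.
    + by apply: (absurd _ _ _ n3 e); left; ring.
(* For k = 1 the point following a boundary between two colors is a
   translation mapping the third class, minus its last element, into itself. *)
have after (x : F) (u v w : nat) : distinct_colors u v w ->
    x \in boundary f u v d -> x + d = 0 \/ x + d = d.
  move=> uvw xQ; have [_ [_ [_ _ w3]]] := distinct_colorsE uvw.
  have vuw : distinct_colors v u w by rewrite distinct_colorsCA.
  have [s sC] := arcP F_prime d0 (ends1 w w3).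
  have {}sC t : (t < #|F|)%N ->
      (s + d *+ t \in color_class f w) = (t < #|color_class f w|)%N by apply: sC.
  have memC p : p \in inner f w d -> p + (x + d) \in color_class f w.
    rewrite !inE => /andP[/eqP fp /eqP fpd].
    have eq1 : p + (x + d) = (p + d) + x by rewrite addrA addrAC.
    have : f ((p + (x + d)) / k) = w.
      move: xQ; rewrite inE => /orP[] /andP[/eqP fx /eqP fxd].
        exact: sum_double_color k0 rf _ _ _ _ _ _ _ uvw fp fpd fx fxd eq1.
      exact: sum_double_color k0 rf _ _ _ _ _ _ _ vuw fp fpd fx fxd eq1.
    by rewrite k1 divr1 => ->.
  have nF : (#|color_class f w| < #|F|)%N.
    by apply: color_class_lt; exists x; move: xQ; rewrite inE;
      have [[_ uw vw] _] := distinct_colorsE uvw; case/orP=> /andP[/eqP-> _].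
  have n2 := big w w3.
  have inP i : (i.+1 < #|color_class f w|)%N -> s + d *+ i \in inner f w d.
    move=> i1; have := sC i.+1; have := sC i.
    rewrite !inE -addrA -mulrSr => -> //; last by arith.
    by move=> -> //; [rewrite i1 ltnW|arith].
  have [j jF ej] := mulrn_surj F_prime (x + d) d0.
  (* For j >= 2, let n be the size of class [w]: the point of index n - j, or 0 when j > n, is not
     the last one and would be carried out of the class. *)
  case: j jF ej => [|[|j']] jF ej; [by left|by right|exfalso].
  have : (1 < j'.+2)%N by []; move: j'.+2 jF ej => j jF ej j2.
  have {}jF : (j < #|F|)%N by apply: jF.
  have shiftC i : (i.+1 < #|color_class f w|)%N -> (i + j < #|F|)%N ->
      (i + j < #|color_class f w|)%N.
    move=> i1 ijF; rewrite -sC // mulrnDr addrA -ej; exact/memC/inP.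
  have [jn|jn] := leqP j #|color_class f w|.
    by have := shiftC (#|color_class f w| - j)%N; arith.
  by have := shiftC 0%N; arith.
have cba : distinct_colors c b a by rewrite distinct_colorsAC.
have := ends_boundary F_prime k0 f3 d abc; have := ends_boundary F_prime k0 f3 d bca.
have := ends_boundary F_prime k0 f3 d cab.
rewrite !ends1 // (boundaryC f c a) (boundaryC f c b) (boundaryC f b a) => e1 e2 e3.
(* Each of the three pairs of colors has a boundary point and these points are distinct, but [after]
   leaves only two positions. *)
have /card_gt0P[x xab] : (0 < #|boundary f a b d|)%N by arith.
have /card_gt0P[y ybc] : (0 < #|boundary f b c d|)%N by arith.
have /card_gt0P[z zac] : (0 < #|boundary f a c d|)%N by arith.
have ne_of (u v w v' : nat) (t t' : F) : u != v' -> u != w ->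
    t \in boundary f u v d -> t' \in boundary f v' w d -> t != t'.
  move=> uv' uw tQ; apply: contraTneq => <-; move: tQ; rewrite !inE.
  by move=> /orP[] /andP[/eqP-> /eqP->]; rewrite (negPf uv') (negPf uw) ?andbF.
have xy : x != y by apply: ne_of ab ac xab ybc.
have ca : c != a by rewrite eq_sym.
have cb : c != b by rewrite eq_sym.
have zca : z \in boundary f c a d by rewrite boundaryC.
have xz : x != z by rewrite eq_sym; apply: ne_of ca cb zca xab.
have yz : y != z.
  by rewrite eq_sym; apply: ne_of ab ac zac ybc.
have neq (u v w : F) : u + d = w -> v + d = w -> u = v.
  by move=> <- /addIr.
case: (after _ _ _ _ abc xab) => hx; case: (after _ _ _ _ bca ybc) => hy;
case: (after _ _ _ _ acb zac) => hz;
first [by case/eqP: xy; apply: neq hx hy | by case/eqP: xz; apply: neq hx hz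
  | by case/eqP: yz; apply: neq hy hz].
Qed.

(** * Colors that occur only once *)

Lemma singleton_pair s x y : (forall z, f z = f s -> z = s) -> x != s -> y != s ->
  (x + y = k * s) \/ (s + x = k * y) -> f x = f y.
Proof.
move=> sing xs ys [/rf|/rf] /or3P[] /eqP // h.
- by rewrite (sing _ h) eqxx in xs.
- by rewrite (sing _ h) eqxx in ys.
- by rewrite (sing _ (esym h)) eqxx in xs.
- by rewrite (sing _ (esym h)) eqxx in ys.
Qed.

Lemma translation_invariant (g : F -> nat) t : t != 0 ->
  (forall x, g (x + t) = g x) -> forall x y, g x = g y.
Proof.
move=> t0 gt x y; have [i _ ->] := addrn_surj F_prime x y t0.
by elim: i => [|i IH]; [rewrite mulr0n addr0|rewrite mulrSr addrA gt].
Qed.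

(* Giving [s] the color of [k * s - s] makes the coloring invariant under the
   two maps that send [x] to [k * s - x] and to [k * x - s]; their commutator
   is the translation by [(k - 2) * (k + 1) * s]. *)
Lemma singleton_nonzero_constant s : s != 0 -> k != 2%:R -> k != -1 ->
    (forall z, f z = f s -> z = s) ->
  forall x y, x != s -> y != s -> f x = f y.
Proof.
move=> s0 k2 kN1 sing.
pose r x := k * s - x; pose h x := k * x - s; pose s' := k * s - s.
have s's : s' != s.
  rewrite /s' subr_eq -subr_eq0 -mulr2n -mulr_natl -mulrBl mulf_neq0 //.
  by rewrite subr_eq0.
pose g x := if x == s then f s' else f x.
have gs : g s = f s' by rewrite /g eqxx.
have gE x : x != s -> g x = f x by rewrite /g => /negPf ->.
have gr x : g (r x) = g x.
  have [->|xs] := eqVneq x s; first by rewrite /r -/s' gs gE.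
  have [rxs|rxs] := eqVneq (r x) s.
    rewrite rxs gs (gE x xs); congr f.
    by rewrite /s' -{2}rxs /r opprB addrC subrK.
  rewrite !gE //; apply: (@singleton_pair s) => //; left.
  by rewrite /r subrK.
have h_inj : injective h by move=> x y /addIr /(mulfI k0).
have [y0 y0E] : exists y, h y = s.
  by exists ((s + s) / k); rewrite /h mulrC divfK // addrK.
have gh1 x : x != y0 -> g (h x) = g x.
  move=> xy0; have hxs : h x != s by rewrite -y0E (inj_eq h_inj).
  have [->|xs] := eqVneq x s; first by rewrite /h -/s' gs gE.
  rewrite !gE //; apply: (@singleton_pair s) => //; right.
  by rewrite /h addrC subrK.
have gh x : g (h x) = g x.
  have [->|] := eqVneq x y0; last exact: gh1.
  (* The bijection [h] preserves colors away from [y0]; counting the points that share the color of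
     [y0] before and after [h] settles [y0] itself. *)
  have sumE : (\sum_x (g (h x) == g y0) = \sum_x (g x == g y0))%N.
    have h_bij : bijective h by apply: injF_bij.
    by rewrite [RHS](reindex h) //; apply: onW_bij.
  move: sumE; rewrite (bigD1 y0) //= [RHS](bigD1 y0) //= eqxx.
  rewrite (eq_bigr (fun x => (g x == g y0) : nat)); last first.
    by move=> y /gh1 ->.
  by case: eqP => // _ /eqP; rewrite eqn_add2r.
have g_const : forall x y, g x = g y.
  apply: (@translation_invariant g ((k - 2%:R) * (k + 1) * s)).
    by rewrite !mulf_neq0 // ?subr_eq0 // addr_eq0.
  move=> z; pose x := (k * s + s - z) / k.
  have kx : k * x = k * s + s - z by rewrite /x mulrC divfK.
  have <- : r (h x) = z by rewrite /r /h kx; ring.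
  have -> : r (h x) + (k - 2%:R) * (k + 1) * s = h (r x) by rewrite /r /h; ring.
  by rewrite gh gr gr gh.
by move=> x y xs ys; rewrite -(gE x xs) -(gE y ys); apply: g_const.
Qed.

End Obstructions.

(** * Rainbow-free colorings with three or four colors *)

Definition rainbow_free_coloring (F : finFieldType) (k : F) (f : F -> nat) : Prop :=
  forall x y z, x + y = k * z -> [|| f x == f y, f x == f z | f y == f z].

Section Forcing.

Variables (F : finFieldType) (k : F).
Hypothesis F_prime : prime #|F|.
Hypothesis k0 : k != 0.

(** The triples (x, -x, 0) and (0, k x, x) force [x], [-x] and [k x] to share a color. *)
Lemma zero_singleton_constant (f : F -> nat) :
    rainbow_free_coloring k f -> (forall z, f z = f 0 -> z = 0) ->
    (forall y, y != 0 -> exists i, y = k ^+ i \/ y = - k ^+ i) ->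
  forall x y, x != 0 -> y != 0 -> f x = f y.
Proof.
move=> rf sing gen.
have fN x : x != 0 -> f (- x) = f x.
  move=> x0; apply: (singleton_pair rf sing) => //; rewrite ?oppr_eq0 //; left.
  by rewrite addNr mulr0.
have fk x : x != 0 -> f (k * x) = f x.
  move=> x0; apply: (singleton_pair rf sing) => //; rewrite ?mulf_neq0 //; right.
  by rewrite add0r.
have fX i : f (k ^+ i) = f 1.
  by elim: i => [|i IH]; rewrite ?expr0 // exprS fk ?expf_neq0.
have f1 x : x != 0 -> f x = f 1.
  by case/gen=> i [] ->; rewrite ?fN ?fX // expf_neq0.
by move=> x y x0 y0; rewrite !f1.
Qed.

Lemma singleton_class (f : F -> nat) c : #|color_class f c| = 1%N ->
  exists s, f s = c /\ forall z, f z = f s -> z = s.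
Proof.
move/eqP/cards1P=> [s sE]; have : s \in color_class f c by rewrite sE inE.
rewrite inE => /eqP fs; exists s; split=> // z fz; apply/set1P.
by rewrite -sE inE fz fs.
Qed.

Lemma three_colors_not_rainbow_free (f : F -> nat) :
    (forall y, y != 0 -> exists i, y = k ^+ i \/ y = - k ^+ i) ->
    (forall x, (f x < 3)%N) -> (forall c, (c < 3)%N -> exists x, f x = c) ->
    rainbow_free_coloring k f -> False.
Proof.
move=> gen f3 onto rf.
have constant_false (s : F) : ~ (forall x y, x != s -> y != s -> f x = f y).
  move=> const; have [a ab] : exists a b, distinct_colors (f s) a b.
    by have := f3 s; move: (f s) => [|[|[|?]]] // _;
      [exists 1%N, 2%N|exists 0%N, 2%N|exists 0%N, 1%N].
  case: ab => b sab; have [[sa sb ab] [_ [_ a3 b3]]] := distinct_colorsE sab.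
  have [[x fx] [y fy]] := (onto _ a3, onto _ b3).
  have xs : x != s by apply: contraNneq sa => <-; rewrite fx.
  have ys : y != s by apply: contraNneq sb => <-; rewrite fy.
  by move: ab; rewrite -fx -fy (const x y xs ys) eqxx.
have zero_false : ~ (forall z, f z = f 0 -> z = 0).
  by move=> /(zero_singleton_constant rf) /(_ gen); apply: constant_false.
have cls_gt0 c : (c < 3)%N -> (0 < #|color_class f c|)%N.
  by case/onto=> x fx; apply/card_gt0P; exists x; rewrite inE fx.
have card3 := card_classes f3 (isT : distinct_colors 0 1 2).
have [kN1|kN1] := eqVneq k (-1).
  (* For k = -1 the signed powers are only 1 and -1, and a nonzero 2 would have to be one of them.
     So the field has at most three elements, and three colors make every class, that of 0 included,
     a singleton. *)
  have q5 : (#|F| < 5)%N.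
    rewrite ltnNge; apply/negP=> q5.
    have n2 := @natr_neq0 F F_prime 2 isT (leq_trans (isT : (2 < 5)%N) q5).
    have n3 := @natr_neq0 F F_prime 3 isT (leq_trans (isT : (3 < 5)%N) q5).
    have [i] := gen _ n2; rewrite kN1 -signr_odd.
    have e1 : 2%:R <> 1 :> F.
      by move=> e; move: (oner_neq0 F); rewrite -{1}(addrK 1 1) -[1 + 1]/(2%:R) e subrr eqxx.
    have e2 : 2%:R <> -1 :> F.
      by move=> e; move: n3; rewrite -[3%:R]/(1 + 2%:R) e subrr eqxx.
    by case: (odd i); rewrite ?expr1 ?expr0 ?opprK; case.
  apply: zero_false => z fz.
  have c1 : #|color_class f (f 0)| = 1%N.
    have := cls_gt0 0%N isT; have := cls_gt0 1%N isT; have := cls_gt0 2%N isT.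
    have q3 : (#|F| <= 3)%N by move: F_prime q5; move: #|F| => [|[|[|[|[|?]]]]].
    have := f3 0; move: (f 0) => [|[|[|?]]] // _; arith.
  have [s [fs sing]] := singleton_class c1.
  have zs : z = s by apply: sing; rewrite fz fs.
  have os : 0 = s by apply: sing; rewrite fs.
  by rewrite zs -os.
have [c c3 c1] : exists2 c, (c < 3)%N & #|color_class f c| = 1%N.
  case: (pickP [pred c : 'I_3 | #|color_class f c| == 1%N]) => [c /eqP cE|none].
    by exists (val c); [apply: ltn_ord|].
  have big c : (c < 3)%N -> (1 < #|color_class f c|)%N.
    move=> c3; have := cls_gt0 c c3; have /= := none (Ordinal c3).
    by rewrite leq_eqVlt eq_sym => ->.
  have [d d0 ends1] := classes_are_progressions F_prime k0 f3 rf big.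
  by case: (no_three_progressions F_prime k0 rf kN1 d0 f3 big ends1).
have [s [_ sing]] := singleton_class c1.
have [s0|s0] := eqVneq s 0; first by apply: zero_false => z; rewrite -s0; exact: sing.
have [k2|k2] := eqVneq k 2%:R; last first.
  exact: (constant_false s (singleton_nonzero_constant F_prime k0 rf s0 k2 kN1 sing)).
pose g x := f (x + s).
have rg : rainbow_free_coloring k g.
  move=> x y z e; apply: rf; rewrite mulrDr -e k2 mulr_natl mulr2n.
  by rewrite addrACA.
have sing_g z : g z = g 0 -> z = 0.
  by rewrite /g add0r => /sing /eqP; rewrite -subr_eq0 addrK => /eqP.
have g_const := zero_singleton_constant rg sing_g gen.
apply: (constant_false s) => x y xs ys.
have := g_const (x - s) (y - s); rewrite /g !subrK !subr_eq0; exact.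
Qed.

(** The equation is x + y + z = 0. The singleton [u] identifies the colors of x and -u - x, and the
    singleton v = -2u those of -u - x and x + 3u. Along the progression of difference 3u, the points
    v and u are neighbours, so all other points form one unbroken chain. *)
Lemma chain_constant (f : F -> nat) u : (4 < #|F|)%N -> k = -1 -> 3%:R != 0 :> F -> u != 0 ->
    rainbow_free_coloring k f -> (forall z, f z = f u -> z = u) ->
    (forall z, f z = f (- (u + u)) -> z = - (u + u)) ->
  forall x y, x != u -> x != - (u + u) -> y != u -> y != - (u + u) -> f x = f y.
Proof.
move=> q5 kN1 n3 u0 rf singu; set v := - (u + u) => singv.
pose t := u + u + u; have t0 : t != 0.
  have -> : t = 3%:R * u by rewrite /t; ring.
  by rewrite mulf_neq0.
have step x : x != u -> x != v -> x != v - t -> f (x + t) = f x.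
  move=> xu xv xvt; pose y := - u - x.
  have yu : y != u.
    by apply: contraNneq xv => yu; rewrite /v -{2}yu /y; apply/eqP; ring.
  have yv : y != v.
    apply: contraNneq xu => yv; have -> : x = - u - y by rewrite /y; ring.
    by rewrite yv /v; apply/eqP; ring.
  have xtv : x + t != v by apply: contraNneq xvt => <-; rewrite addrK.
  rewrite (singleton_pair rf singu xu yu); last first.
    by right; rewrite kN1 /y; ring.
  apply/esym; apply: (singleton_pair rf singv yv xtv); right.
  by rewrite kN1 /y /v /t; ring.
pose p j := v - t - t *+ (#|F| - 3) + t *+ j.
have q3 : (3 <= #|F|)%N by arith.
have pE j i : p j = p i -> (j < #|F|)%N -> (i < #|F|)%N -> j = i.
  by move=> /addrI e jF iF; apply: (mulrn_inj F_prime t0 jF iF e).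
have p3 : p (#|F| - 3)%N = v - t by rewrite /p subrK.
have p2 : p (#|F| - 2)%N = v.
  have -> : (#|F| - 2 = (#|F| - 3).+1)%N by arith.
  by rewrite /p mulrSr addrA subrK subrK.
have p1 : p (#|F| - 1)%N = u.
  have -> : (#|F| - 1 = (#|F| - 3).+2)%N by arith.
  by rewrite /p 2!mulrSr; move: (t *+ (#|F| - 3)) => T; rewrite /v /t; ring.
have p_const j : (j + 3 <= #|F|)%N -> f (p j) = f (p 0%N).
  elim: j => [//|j IH] jF; have -> : p j.+1 = p j + t by rewrite /p mulrSr addrA.
  rewrite step ?IH //; try by arith.
  - by apply/eqP; rewrite -p1 => /pE; arith.
  - by apply/eqP; rewrite -p2 => /pE; arith.
  - by apply/eqP; rewrite -p3 => /pE; arith.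
have f_const x : x != u -> x != v -> f x = f (p 0%N).
  have [j jF ->] := addrn_surj F_prime (p 0%N) x t0.
  have -> : p 0%N + t *+ j = p j by rewrite /p mulr0n addr0.
  rewrite -{1}p1 -{1}p2 => j1 j2; apply: p_const.
  have {}jF : (j < #|F|)%N by apply: jF.
  have : j != (#|F| - 1)%N by apply: contraNneq j1 => ->.
  have : j != (#|F| - 2)%N by apply: contraNneq j2 => ->.
  by lia.
by move=> x y *; rewrite !f_const.
Qed.

Lemma two_other_colors i j : (i < 4)%N -> (j < 4)%N ->
  exists a b, [/\ (a < 4)%N, (b < 4)%N & [&& a != b, a != i, a != j, b != i & b != j]].
Proof.
by move: i j => [|[|[|[|?]]]] [|[|[|[|?]]]] // _ _;
  first [by exists 0%N, 1%N|by exists 0%N, 2%N|by exists 0%N, 3%N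
        |by exists 1%N, 2%N|by exists 1%N, 3%N|by exists 2%N, 3%N].
Qed.

(** Two further colors occur off [u] and [v], so constancy off a nonzero singleton is absurd. The
    exceptional values are k = 2, where the triple (u, 2v - u, v) is rainbow, and k = -1, where -(u
    + v) must be [u] or [v], the situation of [chain_constant]. *)
Lemma two_singletons_false (f : F -> nat) u v : (4 < #|F|)%N ->
    (forall x, (f x < 4)%N) -> (forall c, (c < 4)%N -> exists x, f x = c) ->
    rainbow_free_coloring k f -> u != v ->
    (forall z, f z = f u -> z = u) -> (forall z, f z = f v -> z = v) -> False.
Proof.
move=> q5 f4 onto rf uv singu singv.
have n2 := @natr_neq0 F F_prime 2 isT (leq_trans (isT : (2 < 5)%N) q5).
have n3 := @natr_neq0 F F_prime 3 isT (leq_trans (isT : (3 < 5)%N) q5).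
have [x [y [[xu xv] [yu yv] fxy]]] : exists x y,
    [/\ x != u /\ x != v, y != u /\ y != v & f x != f y].
  have [a [b [a4 b4 /and5P[ab au av bu bv]]]] := two_other_colors (f4 u) (f4 v).
  have [[x fx] [y fy]] := (onto a a4, onto b b4); exists x, y.
  rewrite fx fy; split=> //; split.
  - by apply: contraNneq au => <-; rewrite fx.
  - by apply: contraNneq av => <-; rewrite fx.
  - by apply: contraNneq bu => <-; rewrite fy.
  - by apply: contraNneq bv => <-; rewrite fy.
have [k2|k2] := eqVneq k 2%:R.
  have := @rf u (v + v - u) v; rewrite addrC subrK k2 mulr_natl => /(_ erefl).
  case/or3P=> /eqP e.
  - have : 2%:R * (v - u) = (v + v - u) - u by ring.
    rewrite (singu _ (esym e)) subrr => /eqP.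
    by rewrite mulf_eq0 (negPf n2) subr_eq0 eq_sym (negPf uv).
  - by move: uv; rewrite (singv _ e) eqxx.
  - have : v - u = (v + v - u) - v by ring.
    by rewrite (singv _ e) subrr => /eqP; rewrite subr_eq0 eq_sym (negPf uv).
have [kN1|kN1] := eqVneq k (-1); last first.
  have [u0|u0] := eqVneq u 0.
    have v0 : v != 0 by rewrite -u0 eq_sym.
    have := singleton_nonzero_constant F_prime k0 rf v0 k2 kN1 singv.
    by move/(_ x y xv yv)/eqP; rewrite (negPf fxy).
  have := singleton_nonzero_constant F_prime k0 rf u0 k2 kN1 singu.
  by move/(_ x y xu yu)/eqP; rewrite (negPf fxy).
have [e|e] : v = - (u + u) \/ u = - (v + v).
  have := @rf u v (- (u + v)); rewrite kN1 mulN1r opprK => /(_ erefl).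
  case/or3P=> /eqP h.
  - by move: uv; rewrite (singv _ h) eqxx.
  - by left; have := singu _ (esym h) => e; rewrite -{1}e; ring.
  - by right; have := singv _ (esym h) => e; rewrite -{1}e; ring.
- have u0 : u != 0 by apply: contraNneq uv => u0; rewrite e u0 addr0 oppr0.
  rewrite e in singv xv yv.
  have := chain_constant q5 kN1 n3 u0 rf singu singv xu xv yu yv.
  by apply/eqP.
- have v0 : v != 0 by apply: contraNneq uv => v0; rewrite e v0 addr0 oppr0.
  rewrite e in singu xu yu.
  have := chain_constant q5 kN1 n3 v0 rf singv singu xv xu yv yu.
  by apply/eqP.
Qed.

Lemma merged_progressions (f : F -> nat) a x :
    (forall y, (f y < 4)%N) -> rainbow_free_coloring k f ->
    (a < 4)%N -> (x < 4)%N -> x != a ->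
    (forall c, (c < 4)%N -> c != a -> (1 < #|color_class f c|)%N) ->
  exists d, [/\ d != 0,
    forall c, (c < 4)%N -> c != a -> c != x -> exits d (color_class f c) = 1%N &
    exits d (color_class f a :|: color_class f x) = 1%N].
Proof.
move=> f4 rf a4 x4 xa big.
(* [unbump a] renumbers the three colors other than [a] as 0, 1, 2. Merging colors cannot create a
   rainbow triple. *)
pose g z := unbump a (if f z == a then x else f z).
have unb3 y : (y < 4)%N -> y != a -> (unbump a y < 3)%N by rewrite /unbump; lia.
have unb_inj y y' : y != a -> y' != a -> (unbump a y == unbump a y') = (y == y').
  by move=> ya ya'; apply/eqP/eqP=> [|-> //]; exact: (can_in_inj (@unbumpK a)).
have g3 z : (g z < 3)%N by rewrite /g; case: eqP => [_|/eqP fa]; apply: unb3.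
have rg : rainbow_free_coloring k g.
  move=> y y' z /rf; rewrite /g.
  by case/or3P=> /eqP ->; rewrite eqxx ?orbT.
have cls_ne y : y != a -> y != x -> color_class g (unbump a y) = color_class f y.
  move=> ya yx; apply/setP=> z; rewrite !inE /g; case: (eqVneq (f z) a) => [->|fa].
    by rewrite unb_inj // eq_sym (negPf yx) eq_sym (negPf ya).
  by rewrite unb_inj.
have cls_x : color_class g (unbump a x) = color_class f a :|: color_class f x.
  apply/setP=> z; rewrite !inE /g; case: (eqVneq (f z) a) => [_|fa].
    by rewrite eqxx.
  by rewrite unb_inj.
have big_g c : (c < 3)%N -> (1 < #|color_class g c|)%N.
  move=> c3; have ca : bump a c != a by rewrite eq_sym neq_bump.
  have c4 : (bump a c < 4)%N by rewrite /bump; lia.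
  rewrite -(bumpK a c); have [->|cx] := eqVneq (bump a c) x.
    rewrite cls_x; apply: leq_trans (big x x4 xa) _.
    by apply/subset_leq_card/subsetUr.
  by rewrite cls_ne //; apply: big.
have [d d0 ends1] := classes_are_progressions F_prime k0 g3 rg big_g.
exists d; split=> // [c c4 ca cx|].
  by rewrite -cls_ne //; apply: ends1; apply: unb3.
by rewrite -cls_x; apply: ends1; apply: unb3.
Qed.

(** A progression with at least two points inside and two outside determines its difference up to
    sign, by [arc_exits_multiple] with two exits. *)
Lemma exits_same_direction (S T : {set F}) d d' : d != 0 -> d' != 0 ->
    (1 < #|S|)%N -> (#|S| + 2 <= #|F|)%N -> exits d S = 1%N -> exits d' S = 1%N ->
  exits d' T = exits d T.
Proof.
move=> d0 d'0 S2 SF e1 e2; have [m mF em] := mulrn_surj F_prime d' d0.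
have {}mF : (m < #|F|)%N by apply: mF.
have h := @arc_exits_multiple F F_prime S d m 2 d0 e1.
have : ~~ [&& (2 <= m)%N & (m + 2 <= #|F|)%N].
  by apply/negP=> /andP[m2 mF2]; have := h m2 mF2 S2 SF; rewrite -em e2.
move=> hm; have [m0|[m1|mq]] : m = 0%N \/ m = 1%N \/ m.+1 = #|F| by lia.
- by move: d'0; rewrite em m0 mulr0n eqxx.
- by rewrite em m1.
- have -> : d' = - d by apply: (addIr d); rewrite em -mulrSr mq mulrn_card addNr.
  exact: exitsN.
Qed.

Lemma four_colors_not_rainbow_free (f : F -> nat) :
    (forall x, (f x < 4)%N) -> (forall c, (c < 4)%N -> exists x, f x = c) ->
    rainbow_free_coloring k f -> False.
Proof.
move=> f4 onto rf.
have cls_gt0 c : (c < 4)%N -> (0 < #|color_class f c|)%N.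
  by case/onto=> x fx; apply/card_gt0P; exists x; rewrite inE fx.
have q4 : (3 < #|F|)%N.
  have /fin_all_exists[g gE] : forall c : 'I_4, exists x, f x = c.
    by move=> c; apply: onto.
  have g_inj : injective g.
    by move=> c c' e; apply/val_inj; rewrite /= -(gE c) -(gE c') e.
  by have := max_card (mem (g @: setT)); rewrite card_imset // cardsT card_ord.
have q5 : (4 < #|F|)%N by move: F_prime q4; move: #|F| => [|[|[|[|[|?]]]]].
have [a a4 big] : exists2 a, (a < 4)%N &
    forall c, (c < 4)%N -> c != a -> (1 < #|color_class f c|)%N.
  case: (pickP [pred c : 'I_4 | #|color_class f c| == 1%N]) => [a /eqP aE|none].
    exists (val a); first exact: ltn_ord.
    move=> c c4 ca; rewrite ltn_neqAle cls_gt0 // andbT eq_sym; apply/eqP=> cE.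
    have [u [fu singu]] := singleton_class aE.
    have [v [fv singv]] := singleton_class cE.
    apply: (two_singletons_false q5 f4 onto rf _ singu singv).
    by apply: contraNneq ca => uv; rewrite -fv -uv fu.
  exists 0%N => // c c4 _; have := cls_gt0 c c4; have /= := none (Ordinal c4).
  by rewrite leq_eqVlt eq_sym => ->.
have [b [c [e [b4 c4 e4 nes]]]] : exists b c e, [/\ (b < 4)%N, (c < 4)%N, (e < 4)%N &
    [&& b != a, c != a, e != a, b != c & (b != e) && (c != e)]].
  by move: a a4 {big} => [|[|[|[|?]]]] // _; [exists 1%N, 2%N, 3%N|exists 0%N, 2%N, 3%N
    |exists 0%N, 1%N, 3%N|exists 0%N, 1%N, 2%N].
case/and5P: nes => ba ca ea bc /andP[be ce].
have [ab ac ae] : [/\ a != b, a != c & a != e] by split; rewrite eq_sym.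
have [cb eb ec] : [/\ c != b, e != b & e != c] by split; rewrite eq_sym.
have four y : [|| f y == a, f y == b, f y == c | f y == e].
  have := f4 y; clear -a4 b4 c4 e4 ab ac ae bc be ce.
  by move: (f y) => i; lia.
have dis (u v : nat) : u != v -> [disjoint color_class f u & color_class f v].
  move=> uv; apply/pred0P=> y /=; rewrite !inE; apply/negP=> /andP[/eqP->].
  by rewrite (negPf uv).
have small u v : (v < 4)%N -> u != v -> v != a -> (#|color_class f u| + 2 <= #|F|)%N.
  move=> v4 uv va; have := big v v4 va.
  have : (#|color_class f u :|: color_class f v| <= #|F|)%N by apply: max_card.
  by rewrite cardsU (disjoint_setI0 (dis _ _ uv)) cards0 subn0; arith.
have [db [db0 Hb Ub]] := merged_progressions f4 rf a4 b4 ba big.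
have [dc [dc0 Hc Uc]] := merged_progressions f4 rf a4 c4 ca big.
have [de [de0 He Ue]] := merged_progressions f4 rf a4 e4 ea big.
have same_c T : exits dc T = exits db T.
  apply: (exits_same_direction T db0 dc0 (big e e4 ea) (small e b b4 eb ba)).
    exact: Hb.
  exact: Hc.
have same_e T : exits de T = exits db T.
  apply: (exits_same_direction T db0 de0 (big c c4 ca) (small c b b4 cb ba)).
    exact: Hb.
  exact: He.
have ends_b : exits db (color_class f b) = 1%N by rewrite -same_c; apply: Hc.
have ends_c : exits db (color_class f c) = 1%N by apply: Hb.
have ends_e : exits db (color_class f e) = 1%N by apply: Hb.
rewrite same_c in Uc; rewrite same_e in Ue.
have dU u v : u != v -> (exits db (color_class f u) + exits db (color_class f v) =
    exits db (color_class f u :|: color_class f v) +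
    #|[set x in color_class f u | (x + db)%R \in color_class f v]| +
    #|[set x in color_class f v | (x + db)%R \in color_class f u]|)%N.
  by move=> uv; apply: exits_disjointU; apply: dis.
(* Each merged class has one exit, as has its second constituent, so the exits of class [a] equal
   its passages to and from that other class. Summing over the three others, 3 times the exits of
   [a] equals all passages, which number only 2 times the exits. *)
have := dU _ _ ab; have := dU _ _ ac; have := dU _ _ ae.
rewrite Ub Uc Ue ends_b ends_c ends_e.
have out : exits db (color_class f a) =
  (#|[set x in color_class f a | (x + db)%R \in color_class f b]| +
   #|[set x in color_class f a | (x + db)%R \in color_class f c]| +
   #|[set x in color_class f a | (x + db)%R \in color_class f e]|)%N.
  rewrite /exits -!sum1_card ![X in X = _]big_mkcond ![X in (X + _ + _)%N]big_mkcond.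
  rewrite ![X in (_ + X + _)%N]big_mkcond ![X in (_ + X)%N]big_mkcond -!big_split /=.
  apply: eq_bigr => x _; rewrite !inE; case: (f x == a) => //=.
  case/or4P: (four (x + db)) => /eqP ->;
  by rewrite !(eqxx, negPf ab, negPf ac, negPf ae, negPf bc, negPf be, negPf ce,
    negPf ba, negPf ca, negPf ea, negPf cb, negPf eb, negPf ec).
have inn : exits db (color_class f a) =
  (#|[set x in color_class f b | (x + db)%R \in color_class f a]| +
   #|[set x in color_class f c | (x + db)%R \in color_class f a]| +
   #|[set x in color_class f e | (x + db)%R \in color_class f a]|)%N.
  have -> : exits db (color_class f a) =
      #|shift (- db) [set x in color_class f a | x - db \notin color_class f a]|.
    by rewrite card_shift -exitsN.
  rewrite -!sum1_card ![X in X = _]big_mkcond ![X in (X + _ + _)%N]big_mkcond.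
  rewrite ![X in (_ + X + _)%N]big_mkcond ![X in (_ + X)%N]big_mkcond -!big_split /=.
  apply: eq_bigr => x _; rewrite !inE opprK addrK andbC.
  case: (f (x + db) == a); rewrite ?andbF //= !andbT.
  case/or4P: (four x) => /eqP ->;
  by rewrite !(eqxx, negPf ab, negPf ac, negPf ae, negPf bc, negPf be, negPf ce,
    negPf ba, negPf ca, negPf ea, negPf cb, negPf eb, negPf ec).
have : (0 < exits db (color_class f a))%N.
  apply: (ends_gt0 F_prime db0 (cls_gt0 a a4)).
  by have [x fx] := onto b b4; exists x; rewrite fx.
by clear -out inn; lia.
Qed.

End Forcing.

(** * Signed powers and the rainbow number *)

Section SignedPowers.

Variables (F : finFieldType) (u : {unit F}).

Definition signed_powers : pred F :=
  fun y => [exists v in <[u]>%g, (y == val v) || (y == - val v)].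

Definition minus_one : {unit F} := FinRing.Unit (unitrN1 F).

Lemma val_unit_neq0 (v : {unit F}) : val v != 0.
Proof. by rewrite -unitfE; apply: valP. Qed.

Lemma val_minus_oneM v : val (minus_one * v)%g = - val v.
Proof. by rewrite FinRing.Theory.val_unitM mulN1r. Qed.

Lemma signed_powersN y : signed_powers (- y) = signed_powers y.
Proof.
by apply: eq_existsb => v; rewrite eqr_opp -(eqr_opp (- y)) opprK orbC.
Qed.

Lemma signed_powersM y : signed_powers (val u * y) = signed_powers y.
Proof.
apply/exists_inP/exists_inP=> -[v vU yv].
  exists (u^-1 * v)%g; first by rewrite groupM ?groupV ?cycle_id.
  have -> : val (u^-1 * v)%g = (val u)^-1 * val v.
    by rewrite FinRing.Theory.val_unitM FinRing.Theory.val_unitV.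
  have u0 := val_unit_neq0 u.
  by case/orP: yv => /eqP e; apply/orP; [left|right];
    rewrite -?mulrN -e mulKf.
exists (u * v)%g; first by rewrite groupM ?cycle_id.
rewrite FinRing.Theory.val_unitM.
by case/orP: yv => /eqP->; rewrite ?mulrN eqxx ?orbT.
Qed.

Lemma signed_powersP y : reflect (exists i, y = val u ^+ i \/ y = - val u ^+ i)
  (signed_powers y).
Proof.
apply: (iffP exists_inP) => [[v /cycleP[i ->] /orP[] /eqP ->]|[i e]].
- by exists i; left; rewrite FinRing.Theory.val_unitX.
- by exists i; right; rewrite FinRing.Theory.val_unitX.
exists (u ^+ i)%g; first exact: mem_cycle.
by rewrite FinRing.Theory.val_unitX; case: e => ->; rewrite eqxx ?orbT.
Qed.

Lemma minus_one_sqr : (minus_one * minus_one = 1)%g.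
Proof. by apply/val_inj; rewrite /= mulrNN mulr1. Qed.

(** The signed powers are the union of <u> and -<u>: this is <u> if it contains -1, and has twice
    the order of [u] otherwise. As -1 has order 2 in odd characteristic, it lies outside <u> when
    that order is odd. *)
Lemma signed_powers_all : prime #|F| ->
    (forall y, y != 0 -> signed_powers y) <->
  generator [set: {unit F}] u \/ #[u]%g = #|F|.-1./2 /\ odd #|F|.-1./2.
Proof.
move=> F_prime; have cU := card_finField_unit F.
have cosets : (minus_one \notin <[u]>)%g ->
    #|<[u]> :|: [set minus_one * v | v in <[u]>]|%g = (#[u]%g + #[u]%g)%N.
  move=> N1; rewrite cardsU (card_imset _ (mulgI _)).
  rewrite (_ : _ :&: _ = set0) ?cards0 ?subn0 //.
  apply/setP=> w; rewrite !inE; apply/negP=> /andP[wU /imsetP[v vU we]].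
  by move: N1; rewrite -(groupMr _ vU) -we wU.
split=> [all|].
  have [N1|N1] := boolP (minus_one \in <[u]>%g).
    left; rewrite /generator eq_sym eqEsubset subsetT.
    apply/subsetP=> w _; have /exists_inP[v vU] := all _ (val_unit_neq0 w).
    case/orP=> /eqP e; first by rewrite (val_inj e).
    by rewrite (_ : w = minus_one * v)%g ?groupM //; apply/val_inj; rewrite e val_minus_oneM.
  right; have : #|F|.-1 = (#[u]%g + #[u]%g)%N.
    rewrite -cU -cosets //; congr #|pred_of_set _|; apply/esym/setP=> w; rewrite !inE.
    have /exists_inP[v vU /orP[] /eqP e] := all _ (val_unit_neq0 w).
      by rewrite (val_inj e) vU.
    apply/orP; right; apply/imsetP; exists v => //; apply/val_inj.
    by rewrite val_minus_oneM.
  rewrite addnn => ->; rewrite doubleK; split=> //.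
  (* If the order were 2j, [u ^+ j] would be a square root of 1 other than 1, hence -1. *)
  apply: contraR N1 => even.
  have /dvdnP[j je] : (2 %| #[u]%g)%N by rewrite dvdn2.
  have j0 : (0 < j)%N by have := order_gt0 u; rewrite je muln_gt0 => /andP[].
  suff -> : minus_one = (u ^+ j)%g by apply: mem_cycle.
  have sq : val (u ^+ j)%g ^+ 2 = 1.
    by rewrite -FinRing.Theory.val_unitX -expgM -je expg_order.
  move/eqP: sq; rewrite sqrf_eq1 => /orP[] /eqP e; last by apply/val_inj; rewrite e.
  have : (u ^+ j == 1)%g by apply/eqP/val_inj; rewrite e.
  rewrite -order_dvdn je => /(dvdn_leq j0); lia.
case=> [gen|[oE odd_half]] y y0.
  have yU : y \is a GRing.unit by rewrite unitfE.
  apply/exists_inP; exists (FinRing.Unit yU); last by rewrite /= eqxx.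
  by move: gen; rewrite /generator => /eqP <-; rewrite inE.
have q_gt2 : (2 < #|F|)%N by move: odd_half; move: #|F| => [|[|[|?]]].
have q_odd : odd #|F| by case: (even_prime F_prime) => // e2; rewrite e2 in q_gt2.
have N1_neq1 : minus_one != 1%g.
  apply/eqP=> /(congr1 val) /= e.
  have : 1 *+ 2 == 0 :> F by rewrite mulr2n -{1}e addNr.
  rewrite (mulrn_eq0_card F_prime) ?oner_eq0 // => /(dvdn_leq (isT : (0 < 2)%N)) h.
  have {}h : (#|F| <= 2)%N by apply: h.
  by rewrite leqNgt q_gt2 in h.
have N1 : (minus_one \notin <[u]>)%g.
  apply/negP=> /order_dvdG; rewrite -/(#[u]%g) oE.
  have -> : #[minus_one]%g = 2%N.
    by apply: nt_prime_order; rewrite // expgS expg1 minus_one_sqr.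
  by rewrite dvdn2 odd_half.
have all : <[u]>%g :|: [set (minus_one * v)%g | v in <[u]>%g] = [set: {unit F}].
  apply/eqP; rewrite eqEcard subsetT cosets // cU oE addnn.
  have even_q1 : odd #|F|.-1 = false.
    by move: q_odd q_gt2; case: #|F| => //= n /negbTE.
  by rewrite -[X in (X <= _)%N]odd_double_half even_q1 add0n leqnn.
have yU : y \is a GRing.unit by rewrite unitfE.
have := in_setT (FinRing.Unit yU); rewrite -all inE => /orP[yP|].
  by apply/exists_inP; exists (FinRing.Unit yU); rewrite ?eqxx.
case/imsetP=> v vU e; apply/exists_inP; exists v => //.
by apply/orP; right; rewrite -val_minus_oneM -e.
Qed.

End SignedPowers.

Section Transfer.

Variables (p q : nat).
Hypothesis q_prime : prime q.

Definition field_of_ord (x : 'I_q) : 'F_q := (x : nat)%:R.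

Definition ord_of_field (y : 'F_q) : 'I_q :=
  Ordinal (ltn_pmod (y : nat) (prime_gt0 q_prime)).

Lemma ord_of_fieldK : cancel ord_of_field field_of_ord.
Proof.
move=> y; rewrite /field_of_ord /=; apply/val_inj.
rewrite /= val_Fp_nat // modn_mod; apply: modn_small.
by have := ltn_ord y; rewrite {2}Fp_cast.
Qed.

Lemma field_of_ordK : cancel field_of_ord ord_of_field.
Proof.
move=> x; apply/val_inj; rewrite /= /field_of_ord val_Fp_nat // modn_mod.
exact: modn_small.
Qed.

Lemma triple_field x y z : triple p%:Z x y z =
  (field_of_ord x + field_of_ord y == p%:R * field_of_ord z).
Proof.
rewrite /triple eqz_mod_dvd (dvdz_pcharf (pchar_Fp q_prime)).
by rewrite rmorphB /= rmorphD rmorphM /= -!pmulrn subr_eq0.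
Qed.

Lemma rainbow_free_field r (c : {ffun 'I_q -> 'I_r}) : rainbow_free p%:Z c ->
  rainbow_free_coloring (p%:R : 'F_q) (fun y => c (ord_of_field y)).
Proof.
move=> /existsPn H x y z e; have /existsPn/(_ (ord_of_field y)) := H (ord_of_field x).
move=> /existsPn/(_ (ord_of_field z)).
rewrite triple_field !ord_of_fieldK e eqxx /= /rainbow.
by rewrite !negb_and !negbK -!val_eqE.
Qed.

Lemma coloring_onto r (c : {ffun 'I_q -> 'I_r}) : is_coloring c ->
  forall i, (i < r)%N -> exists y, c (ord_of_field y) = i :> nat.
Proof.
move=> /forallP onto i ir; have /existsP[x /eqP cx] := onto (Ordinal ir).
by exists (field_of_ord x); rewrite field_of_ordK cx.
Qed.

Lemma rainbow_forcing3 (u : {unit 'F_q}) : val u = p%:R ->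
  (forall y, y != 0 -> signed_powers u y) -> rainbow_forcing q p%:Z 3.
Proof.
move=> uE all; apply/andP; split=> //; apply/forallP=> c; apply/implyP=> onto.
have F_prime : prime #|'F_q| by rewrite card_Fp.
have k0 : p%:R != 0 :> 'F_q by rewrite -uE val_unit_neq0.
apply/negP=> /rainbow_free_field rf.
apply: (three_colors_not_rainbow_free F_prime k0 _ _ (coloring_onto onto) rf).
- by move=> y /all/signed_powersP; rewrite uE.
- by move=> y; apply: ltn_ord.
Qed.

Lemma rainbow_forcing4 : p%:R != 0 :> 'F_q -> rainbow_forcing q p%:Z 4.
Proof.
move=> k0; apply/andP; split=> //; apply/forallP=> c; apply/implyP=> onto.
have F_prime : prime #|'F_q| by rewrite card_Fp.
apply/negP=> /rainbow_free_field rf.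
apply: (four_colors_not_rainbow_free F_prime k0 _ (coloring_onto onto) rf).
by move=> y; apply: ltn_ord.
Qed.

Lemma not_rainbow_forcing3 (u : {unit 'F_q}) : val u = p%:R ->
  ~ (forall y, y != 0 -> signed_powers u y) -> ~~ rainbow_forcing q p%:Z 3.
Proof.
move=> uE not_all.
have [w w0 wN] : exists2 w : 'F_q, w != 0 & ~~ signed_powers u w.
  have [/forallP all|] := boolP [forall y, (y != 0) ==> signed_powers u y].
    by case: not_all => y; apply/implyP.
  by rewrite negb_forall => /existsP[w]; rewrite negb_imply => /andP[]; exists w.
pose g (y : 'F_q) : 'I_3 :=
  if y == 0 then inord 0 else if signed_powers u y then inord 1 else inord 2.
have gN y : g (- y) = g y by rewrite /g oppr_eq0 signed_powersN.
have gM y : g (val u * y) = g y.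
  by rewrite /g mulf_eq0 (negPf (val_unit_neq0 u)) signed_powersM.
pose c := [ffun x : 'I_q => g (field_of_ord x)].
apply/negP=> /andP[_ /forallP/(_ c)/implyP H]; suff: rainbow_free p%:Z c.
  apply/negP; apply: H; apply/forallP=> i.
  have [y yE] : exists y, g y = i.
    case: i => [[|[|[|//]]] i3].
    - by exists 0; rewrite /g eqxx; apply/val_inj; rewrite /= inordK.
    - exists 1; rewrite /g oner_eq0; have -> : signed_powers u 1.
        by apply/signed_powersP; exists 0%N; left.
      by apply/val_inj; rewrite /= inordK.
    - by exists w; rewrite /g (negPf w0) (negPf wN); apply/val_inj; rewrite /= inordK.
  by apply/existsP; exists (ord_of_field y); rewrite ffunE ord_of_fieldK yE.
apply/existsPn=> x1; apply/existsPn=> x2; apply/existsPn=> x3.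
rewrite triple_field /rainbow !ffunE -uE.
move: (field_of_ord x1) (field_of_ord x2) (field_of_ord x3) => x y z.
apply/negP=> /andP[/eqP e /and3P[xy xz yz]].
have z0 : z != 0.
  apply: contraNneq xy => z0; rewrite -(gN x).
  by have -> : - x = y by apply/eqP; rewrite eq_sym -addr_eq0 addrC e z0 mulr0.
have x0 : x != 0.
  by apply: contraNneq yz => x0; rewrite -(gM z) -e x0 add0r.
have y0 : y != 0.
  by apply: contraNneq xz => y0; rewrite -(gM z) -e y0 addr0.
move: xy xz yz; rewrite /g (negPf x0) (negPf y0) (negPf z0).
by do 3!case: (signed_powers u _); rewrite ?eqxx.
Qed.

End Transfer.

(** Nothing is rainbow with at most two colors, and [1 < q] provides a coloring that is onto. *)
Lemma not_rainbow_forcing_lt3 q k r : (1 < q)%N -> (r < 3)%N -> ~~ rainbow_forcing q k r.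
Proof.
move=> q1 r3; apply/negP=> /andP[r0 /forallP H].
case: r r3 r0 H => // r r3 _ H.
pose c := [ffun x : 'I_q => inord (minn x r) : 'I_r.+1].
have := H c; apply/negP; rewrite negb_imply negbK; apply/andP; split.
  apply/forallP=> i; apply/existsP.
  have iq : (i < q)%N by have := ltn_ord i; lia.
  exists (Ordinal iq); rewrite ffunE; apply/eqP/val_inj.
  by rewrite /= inordK; have := ltn_ord i; lia.
apply/existsPn=> x; apply/existsPn=> y; apply/existsPn=> z.
apply/negP=> /andP[_ /and3P[]]; rewrite -!val_eqE.
move: (c x) (c y) (c z) => a b d; rewrite /= => ab ad bd.
by have := ltn_ord a; have := ltn_ord b; have := ltn_ord d; lia.
Qed.

Lemma rb_eq q k r : rainbow_forcing q k r ->
  (forall r', (r' < r)%N -> ~~ rainbow_forcing q k r') -> rb q k = r.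
Proof.
move=> Hr small; rewrite /rb; case: ex_minnP => m Hm min_m.
apply/eqP; rewrite eqn_leq min_m //= leqNgt.
by apply/negP=> /small; rewrite Hm.
Qed.

Local Close Scope ring_scope.

Theorem theorem3 (p q : nat) (p_prime : prime p) (q_prime : prime q)
    (p_neq_q : p <> q) :
  (rb q p%:Z = 4 <-> ~ generates_units q p /\ ~ odd_half_order q p) /\
  (generates_units q p \/ odd_half_order q p -> rb q p%:Z = 3).
Proof.
have co_qp : coprime q p by rewrite prime_coprime // dvdn_prime2 // eq_sym; apply/eqP.
have F_prime : prime #|'F_q| by rewrite card_Fp.
(* ['F_q] is ['Z_(pdiv q)], so the residue is taken modulo [pdiv q] for its type to match. *)
pose u : {unit 'F_q} := residue_unit (pdiv q) p.
have uE : (val u = p%:R)%R by apply: residue_unitE; rewrite pdiv_id ?prime_gt1.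
have k0 : (p%:R != 0 :> 'F_q)%R by rewrite -uE val_unit_neq0.
have conds : generates_units q p \/ odd_half_order q p <->
    (forall y, (y != 0)%R -> signed_powers u y).
  apply: iff_trans (iff_sym (signed_powers_all u F_prime)).
  have -> : generates_units q p = generator [set: {unit 'F_q}] u.
    by rewrite -[in LHS](pdiv_id q_prime).
  have -> : odd_half_order q p = (#[u]%g == #|'F_q|.-1./2) && odd #|'F_q|.-1./2.
    have -> : #|'F_q| = pdiv q by rewrite card_Fp // pdiv_id.
    by rewrite -[in LHS](pdiv_id q_prime).
  by split=> -[]; [left | move=> /andP[/eqP]; right | left |
    move=> [/eqP h1 h2]; right; apply/andP].
have rb3 : generates_units q p \/ odd_half_order q p -> rb q p%:Z = 3.
  move=> /conds all; apply: rb_eq => [|r r3]; first exact: rainbow_forcing3 uE all.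
  exact: not_rainbow_forcing_lt3 (prime_gt1 q_prime) r3.
split=> //; split=> [rb4|[not_gen not_half]].
  by split=> cond; [have := rb3 (or_introl cond) | have := rb3 (or_intror cond)]; rewrite rb4.
apply: rb_eq => [|r]; first exact: rainbow_forcing4.
rewrite ltnS leq_eqVlt => /orP[/eqP->|r3].
  by apply: not_rainbow_forcing3 uE _ => // /conds[].
exact: not_rainbow_forcing_lt3 (prime_gt1 q_prime) r3.
Qed.
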